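(* Let $p$ be a prime, $r\ge 1$ an integer, $q=p^r$, and let $(\beta_1,\ldots,\beta_r)$ be an ordered basis of $\mathbb{F}_q$ over $\mathbb{F}_p$, with associated sum-of-digits function $T$. Let $d$ be any integer with $1\le d<q$ and $\gcd(d,q)=1$. Let $d_0$ be the integer with $d_0\equiv d\bmod p$ and $1\le d_0<p$. Let $f(X)\in\mathbb{F}_q[X]$ be any polynomial of degree $d$. 1. For any integer $s$ with $1\le s\le d_0$, any $\mathcal{A}\subset\mathbb{F}_q$ of size $s$ and any $\underline{c}\in\mathbb{F}_p^s$ we have $$\left||\mathcal{T}(\underline{c},\mathcal{A},f)|-p^{r-s}\right|\le (d-1)q^{1/2}.$$ 2. Conversely, if $f(X)\in\mathbb{F}_p[X]$, then for any integer $s$ with $q\ge s\ge d+1$ there is $\mathcal{A}\subset\mathbb{F}_q$ of size $s$ and a vector $\underline{c}\in\mathbb{F}_p^s$ for which $\mathcal{T}(\underline{c},\mathcal{A},f)$ is empty. 3. For any $f(X)\in\mathbb{F}_q[X]$ of degree $d$, any integer $s$ with $q\ge s>dr$ and any $\mathcal{A}\subset\mathbb{F}_q$ of size $s$ there is a vector $\underline{c}\in\mathbb{F}_p^s$ for which $\mathcal{T}(\underline{c},\mathcal{A},f)$ is empty.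
   Context: For $\xi=\sum_{i=1}^r x_i\beta_i\in\mathbb{F}_q$ with $x_i\in\mathbb{F}_p$, the Thue-Morse or sum-of-digits function with respect to the basis $(\beta_1,\ldots,\beta_r)$ is $T(\xi)=\sum_{i=1}^r x_i\in\mathbb{F}_p$. For an integer $s$ with $1\le s\le q$, a set $\mathcal{A}=\{\alpha_1,\ldots,\alpha_s\}\subset\mathbb{F}_q$ of $s$ distinct elements, a polynomial $f(X)\in\mathbb{F}_q[X]$ and a vector $\underline{c}=(c_1,\ldots,c_s)\in\mathbb{F}_p^s$, put $$\mathcal{T}(\underline{c},\mathcal{A},f)=\{\xi\in\mathbb{F}_q: T(f(\xi+\alpha_i))=c_i,\ i=1,\ldots,s\}.$$ $|\cdot|$ of a set denotes its cardinality, and $p^{r-s}$ is a rational number (possibly less than $1$). *)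

(* Defs.v *)
From HB Require Import structures.
From mathcomp Require Import all_boot all_order all_algebra all_field.

Set Implicit Arguments.
Unset Strict Implicit.
Unset Printing Implicit Defensive.

Import GRing.Theory Num.Theory.
Local Open Scope ring_scope.

(* F_q is a field extension L of 'F_p of finite degree; the alias             *)
(* finvect_type L carries its finType structure, hence finite subsets of L    *)
(* and their cardinals.                                                       *)

Definition sum_digits (p r : nat) (L : fieldExtType 'F_p) (beta : r.-tuple L)
    (xi : L) : 'F_p :=
  \sum_(i < r) coord beta i xi.

(* The set A = {alpha_1, ..., alpha_s} is given together with the enumeration *)
(* matching alpha_i to c_i: a tuple, duplicate-free wherever it is used.      *)
Definition TM_set (p r s : nat) (L : fieldExtType 'F_p) (beta : r.-tuple L)
    (c : s.-tuple 'F_p) (alpha : s.-tuple L) (f : {poly L}) :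
    {set finvect_type L} :=
  [set xi : finvect_type L |
    [forall i : 'I_s,
      sum_digits beta f.[(xi : L) + tnth alpha i] == tnth c i]].

(* Main.v *)
Require Import Defs.
From HB Require Import structures.
From mathcomp Require Import all_boot all_order all_algebra all_field.
From mathcomp Require Import qfpoly.
From mathcomp Require Import zify ring.

(* For part 1, expand the indicator of T (f (xi + alpha_i)) = c_i in additive     *)
(* characters: the main term is q / p ^ s, and every other frequency gives a      *)
(* character sum of some sum_i u_i f (X + alpha_i), whose degree lies between 1   *)
(* and d and is prime to p, because it is d - j for the least j such that         *)
(* sum_i u_i alpha_i ^ j != 0, and j < s <= d %% p. The Weil bound applies.       *)
(*                                                                                *)
(* The Weil bound is obtained from Stepanov's method in Bombieri's form. Over a   *)
(* field with s ^ 2 elements, s a large power of p, a nonzero function of         *)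
(* bounded pole order on the curve y ^ p - y = f (x) is made to vanish at all     *)
(* rational points, so that the character sums over the extensions of even        *)
(* degree 2 n are O(q ^ n). These sums are, up to sign, the power sums of the     *)
(* reciprocal roots of an L-function that is a polynomial of degree less than d,  *)
(* hence these roots are bounded by sqrt q.                                       *)
(*                                                                                *)
(* For part 2, a product of difference operators, with few translates, turns f    *)
(* into a constant function, and then one linear relation among the digits        *)
(* T (f (xi + alpha_i)) holds for all xi. Part 3 is the pigeonhole principle:     *)
(* s > r, so there are more than q vectors c.                                     *)

Set Implicit Arguments.
Unset Strict Implicit.
Unset Printing Implicit Defensive.
Import Order.TTheory GRing.Theory Num.Theory.
Local Open Scope ring_scope.

(** * The curve y ^ p - y = f (x) *)

(** Orthogonality of characters reduces the first clause to [weil_bound]; [size_shift_comb] ensures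
    that only polynomials of degree prime to [p] occur.

    The Weil bound joins two facts. First, [stepanov_sum] controls character sums over large
    extensions of even degree. It needs only an upper bound, uniform in delta, for the points of y^p
    - y = f(x) - delta ([curve_points_le]), because a nontrivial character sums to zero over delta.
    Second, [Lchar] is multiplicative, so its generating series has an Euler product: [Lcoef_eq0]
    makes the series a polynomial, [Lcoef_recursion] is its logarithmic derivative, and [LpowerE]
    identifies the logarithmic coefficients with the sums over extensions. Reciprocal roots whose
    power sums of order 2 n are O(q^n) have norm at most sqrt q ([norm_le1_power_sums]); the implied
    constant disappears.

    The second clause rests on [constant_shift_combination]: some family of at most d + 1 translates
    of f has a nontrivial constant combination over ['F_p]. So few translates suffice because what
    matters is the functional degree, where x^k weighs at most its base-p digit sum ([fdeg_le_Xn]),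
    and because the shifts are spread over several directions ([exists_annihilator]). The third
    clause compares p^r points with p^s vectors. *)

Lemma poly_family_dependent (K : fieldType) (I : finType) (g : I -> {poly K}) w :
    (forall i, size (g i) <= w)%N -> (w < #|I|)%N ->
  exists c : I -> K, (exists i, c i != 0) /\ \sum_i c i *: g i = 0.
Proof.
move=> gw wI; pose M : 'M_(#|I|, w) := \matrix_i poly_rV (g (enum_val i)).
have /rowV0Pn[v /sub_kermxP vM /rV0Pn[j vj]] : kermx M != 0.
  by rewrite -mxrank_eq0 mxrank_ker -lt0n subn_gt0 (leq_ltn_trans (rank_leq_col M)).
exists (fun i => v 0 (enum_rank i)); split.
  by exists (enum_val j); rewrite enum_valK.
have -> : \sum_i v 0 (enum_rank i) *: g i = rVpoly (v *m M).
  rewrite mulmx_sum_row linear_sum /= (reindex (fun j : 'I_#|I| => enum_val j)) /=; last first.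
    by apply: onW_bij; exists enum_rank; [exact: enum_valK|exact: enum_rankK].
  by apply: eq_bigr => i _; rewrite linearZ /= rowK poly_rV_K // enum_valK.
by rewrite vM linear0.
Qed.

(** Modulo [p] the weight is d e with [d] invertible, so e < p is determined, and then [i]. *)
Lemma weight_inj p d i e i' e' : (1 < p)%N -> coprime p d ->
  (e < p)%N -> (e' < p)%N ->
  (p * i + d * e = p * i' + d * e')%N -> i = i' /\ e = e'.
Proof.
move=> p_gt1 p_d; wlog ee' : i e i' e' / (e <= e')%N => [W ep e'p H|ep e'p H].
  case: (leqP e e') => [le|/ltnW le]; first exact: W.
  by have [-> ->] := W _ _ _ _ le e'p ep (esym H).
have pe : (p %| d * (e' - e))%N.
  by rewrite -(dvdn_addr _ (dvdn_mulr i' (dvdnn p))) (_ : (_ + _ = p * i)%N) ?dvdn_mulr //; nia.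
rewrite Gauss_dvdr // in pe.
have e0 : (e' - e = 0)%N.
  by apply/eqP; move: pe; case: eqP => // /eqP; rewrite -lt0n => e0 /(dvdn_leq e0); lia.
have ee : e = e' by lia.
by split=> //; move: H; rewrite ee => /addIn/eqP; rewrite eqn_mul2l; case/orP=> /eqP; lia.
Qed.

Section Curve.

Variables (E : fieldType) (p d : nat) (f : {poly E}) (alpha : E).
Hypotheses (p_gt1 : (1 < p)%N) (d_gt0 : (0 < d)%N) (p_d : coprime p d).
Hypotheses (f_size : size f = d.+1) (alphaP : alpha ^+ p = lead_coef f).

Definition curve : {poly {poly E}} := 'X^p - 'X - f%:P.

(* theta maps x ^ i y ^ e to a monomial of degree p i + d e, the pole order at    *)
(* infinity, and the leading terms of y ^ p and f (x) to the same monomial.       *)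
Definition theta (P : {poly {poly E}}) : {poly E} :=
  (map_poly (comp_poly 'X^p) P).[alpha *: 'X^d].

Fact theta_is_zmod_morphism : zmod_morphism theta.
Proof. by move=> P Q; rewrite /theta rmorphB !hornerE. Qed.

Fact theta_is_monoid_morphism : monoid_morphism theta.
Proof. by split=> [|P Q]; rewrite /theta ?rmorph1 ?rmorphM !hornerE. Qed.

HB.instance Definition _ :=
  GRing.isZmodMorphism.Build {poly {poly E}} {poly E} theta theta_is_zmod_morphism.
HB.instance Definition _ :=
  GRing.isMonoidMorphism.Build {poly {poly E}} {poly E} theta theta_is_monoid_morphism.

(** The guard excludes zero coefficients, whose degree would otherwise read as 0. *)
Definition weight_le w (P : {poly {poly E}}) :=
  forall e, P`_e != 0 -> (p * (size (P`_e)%R).-1 + d * e <= w)%N.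

Lemma weight_leB w P Q : weight_le w P -> weight_le w Q -> weight_le w (P - Q).
Proof.
move=> wP wQ e; rewrite coefB => PQ.
have [P0|/wP {}wP] := eqVneq P`_e 0.
  by move: PQ (wQ e); rewrite P0 sub0r oppr_eq0 size_polyN => PQ; apply.
have [Q0|/wQ {}wQ] := eqVneq Q`_e 0; first by rewrite Q0 subr0.
have := size_polyD P`_e (- Q`_e); rewrite size_polyN leq_max => /orP[H|H].
  by apply: leq_trans wP; rewrite leq_add2r leq_mul2l -!subn1 leq_sub2r ?orbT.
by apply: leq_trans wQ; rewrite leq_add2r leq_mul2l -!subn1 leq_sub2r ?orbT.
Qed.

Lemma weight_le_monom w (c : {poly E}) e :
  (p * (size c).-1 + d * e <= w)%N -> weight_le w (c%:P * 'X^e).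
Proof.
by move=> cw i; rewrite coefCM coefXn; have [->|_] := eqVneq i e; rewrite ?mulr1 ?mulr0 ?eqxx.
Qed.

Lemma theta_monom (c : {poly E}) e :
  theta (c%:P * 'X^e) = alpha ^+ e *: ((c \Po 'X^p) * 'X^(d * e)).
Proof.
rewrite rmorphM rmorphXn /= {1}/theta map_polyC hornerC /theta map_polyX hornerX.
by rewrite exprZn -exprM -scalerAr.
Qed.

Lemma size_theta_monom (c : {poly E}) e :
  (size (theta (c%:P * 'X^e)) <= p * (size c).-1 + d * e + 1)%N.
Proof.
rewrite theta_monom (leq_trans (size_scale_leq _ _)) //.
have [->|c1] := eqVneq (c \Po 'X^p) 0; first by rewrite mul0r size_poly0.
rewrite size_mulXn // addnC addnAC leq_add2r.
by have := size_comp_poly_leq c ('X^p); rewrite size_polyXn /= mulnC addn1.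
Qed.

Lemma thetaE P :
  theta P = \sum_(e < size P) theta ((P`_e)%:P * 'X^e).
Proof.
rewrite -rmorph_sum -[in LHS](coefK P) poly_def; congr theta.
by apply: eq_bigr => i _; rewrite mul_polyC.
Qed.

Lemma size_theta w P : weight_le w P -> (size (theta P) <= w.+1)%N.
Proof.
move=> wP; rewrite thetaE; apply: (leq_trans (size_sum _ _ _)).
apply/bigmax_leqP => e _; have [->|/wP Pe] := eqVneq P`_e 0.
  by rewrite mul0r rmorph0 size_poly0.
by apply: leq_trans (size_theta_monom _ _) _; rewrite addn1.
Qed.

(** The two terms of degree p d, from y^p and f(x), cancel because [alpha ^+ p = lead_coef f]. *)
Lemma size_theta_curve : (size (theta curve) <= p * d)%N.
Proof.
rewrite /curve !rmorphB /=.
have -> : theta 'X = alpha *: 'X^d by rewrite /theta map_polyX hornerX.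
have -> : theta 'X^p = (lead_coef f *: 'X^d) \Po 'X^p.
  rewrite rmorphXn /= /theta map_polyX hornerX exprZn alphaP comp_polyZ.
  by rewrite rmorphXn /= comp_polyX -!exprM mulnC.
have -> : theta f%:P = f \Po 'X^p by rewrite /theta map_polyC hornerC.
rewrite addrAC -rmorphB /=; set g := _ *: _ - f.
have gd : (size g <= d)%N.
  apply/leq_sizeP => j; rewrite leq_eqVlt => /orP[/eqP <-|dj]; rewrite coefB coefZ coefXn.
    by rewrite eqxx mulr1 lead_coefE f_size subrr.
  by rewrite gtn_eqF // mulr0 [f`__]nth_default ?f_size ?subr0.
rewrite (leq_trans (size_polyD _ _)) // geq_max size_polyN; apply/andP; split.
  apply: leq_trans (size_comp_poly_leq _ _) _; rewrite size_polyXn /=.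
  by move: gd; case: (size g) => [|n] /=; nia.
by rewrite (leq_trans (size_scale_leq _ _)) // size_polyXn; nia.
Qed.

(* By the last clause, P is nonzero on the curve as soon as theta P has a nonzero *)
(* coefficient of degree w.                                                       *)
Lemma curve_normal_form w P : weight_le w P -> exists N H : {poly {poly E}},
  [/\ P = N + H * curve, (size N <= p)%N, weight_le w N
    & (size (theta P - theta N)%R <= w)%N].
Proof.
have [n] := ubnP (size P); elim: n P => // n IHn P Pn wP.
have [Pp|Pp] := leqP (size P) p.
  by exists P, 0; rewrite mul0r addr0 subrr size_poly0.
set c := lead_coef P; set k := ((size P).-1 - p)%N.
have kp : (k + p)%N = (size P).-1 by rewrite /k; lia.
have c0 : c != 0 by rewrite lead_coef_eq0 -size_poly_gt0; lia.
have cw : (p * (size c).-1 + d * (k + p) <= w)%N.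
  by rewrite kp; apply: wP; rewrite -lead_coefE.
(* The leading c y^(k + p) is replaced by c y^k (y + f); as f has the weight p d of y^p, the weight
   does not grow. *)
pose P1 := P - c%:P * 'X^k * curve.
have P1E : P1 = (P - c%:P * 'X^(k + p)) - (- (c%:P * 'X^(k.+1)) - (c * f)%:P * 'X^k).
  rewrite /P1 /curve exprD exprS polyCM; ring.
have wP1 : weight_le w P1.
  rewrite P1E; apply: weight_leB; [|rewrite -(sub0r (_ * _)); apply: weight_leB].
  - by apply: weight_leB => //; apply: weight_le_monom.
  - apply: weight_leB => [e|]; first by rewrite coef0 eqxx.
    by apply: weight_le_monom; apply: leq_trans cw; rewrite leq_add2l leq_mul2l; lia.
  - apply: weight_le_monom; apply: leq_trans cw; rewrite mulnDr addnCA [leqLHS]addnC leq_add2l.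
    rewrite (mulnC d p) -mulnDr leq_mul2l; apply/orP; right.
    apply: (@leq_trans (size c + size f).-1.-1); last by rewrite f_size addnS /=; lia.
    by rewrite -!subn1 leq_sub2r // subn1 size_polyMleq.
have sP1 : (size P1 < size P)%N.
  suff : (size P1 <= (size P).-1)%N by lia.
  apply/leq_sizeP => j Pj; rewrite P1E !coefB coefN !coefCM !coefXn.
  rewrite [j == k.+1]gtn_eqF ?[j == k]gtn_eqF ?mulr0 ?subr0 ?oppr0 ?addr0 ?subr0; try lia.
  move: Pj; rewrite leq_eqVlt kp => /orP[/eqP <-|Pj].
    by rewrite eqxx mulr1 -lead_coefE subrr.
  by rewrite gtn_eqF // mulr0 subr0 nth_default // (leq_trans (leqSpred _)).
have [||N [H [P1N sN wN tN]]] := IHn P1 => //; first lia.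
exists N, (H + c%:P * 'X^k); split=> //.
  by rewrite mulrDl addrA -P1N /P1 subrK.
have -> : P = P1 + c%:P * 'X^k * curve by rewrite /P1 subrK.
rewrite rmorphD /= addrAC (leq_trans (size_polyD _ _)) // geq_max tN /= rmorphM /=.
apply: leq_trans (size_polyMleq _ _) _.
apply: (@leq_trans (p * (size c).-1 + d * k + 1 + p * d).-1).
  rewrite -subn1 -[leqRHS]subn1 leq_sub2r // leq_add //; [exact: size_theta_monom|exact: size_theta_curve].
by move: cw; rewrite mulnDr (mulnC d p); lia.
Qed.

Lemma coef_theta_monom (c : {poly E}) e k : (theta (c%:P * 'X^e))`_k =
  if (d * e <= k)%N && (p %| k - d * e)%N then alpha ^+ e * c`_((k - d * e) %/ p) else 0.
Proof.
rewrite theta_monom coefZ coefMXn ltnNge; case: leqP => //= H; last by rewrite mulr0.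
rewrite coef_comp_poly_Xn; last lia.
by case: ifP; rewrite ?mulr0.
Qed.

(** Below y-degree [p], distinct monomials have images of distinct degrees, so the coefficient of
    X^(p i + d e) recovers that of x^i y^e up to a power of [alpha]. *)
Lemma theta_inj (P : {poly {poly E}}) : alpha != 0 -> (size P <= p)%N -> theta P = 0 -> P = 0.
Proof.
move=> a0 Pp tP; apply/polyP => e; rewrite coef0; apply/polyP => i; rewrite coef0.
have [ep|pe] := ltnP e p; last by rewrite [P`_e]nth_default ?coef0 // (leq_trans Pp).
have [eP|Pe] := ltnP e (size P); last by rewrite [P`_e]nth_default ?coef0.
have := congr1 (fun Q : {poly E} => Q`_(p * i + d * e)) tP.
rewrite thetaE coef_sum (bigD1 (Ordinal eP)) //= coef0 big1 ?addr0.
  rewrite coef_theta_monom leq_addl addnK dvdn_mulr // mulKn ?(ltnW p_gt1) //=.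
  by move/eqP; rewrite mulf_eq0 expf_eq0 (negPf a0) andbF => /eqP.
move=> e' ne; rewrite coef_theta_monom; case: ifP => // /andP[le /dvdnP[i' H]].
case/eqP: ne; apply/val_inj => /=.
have [|_ //] := @weight_inj p d i e i' e' p_gt1 p_d ep (leq_trans (ltn_ord e') Pp).
by rewrite (mulnC p i') -H subnK.
Qed.

(** An elementary substitute for the Riemann-Roch dimension bound: [theta] embeds the normal forms
    into the polynomials of degree at most [w], a space of dimension w + 1. *)
Lemma curve_dependent (I : finType) (P : I -> {poly {poly E}}) w :
    alpha != 0 -> (forall i, weight_le w (P i)) -> (w.+1 < #|I|)%N ->
  exists c : I -> E, (exists i, c i != 0) /\
    exists H, \sum_i (c i)%:P%:P * P i = H * curve.
Proof.
move=> a0 wP wI.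
have /fin_all_exists[N /fin_all_exists[H NH]] i := curve_normal_form (wP i).
have [i|c [c0 cN]] := @poly_family_dependent _ _ (fun i => theta (N i)) _ _ wI.
  by have [_ _ /size_theta] := NH i.
exists c; split=> //; exists (\sum_i (c i)%:P%:P * H i).
have tC x : theta x%:P%:P = x%:P by rewrite /theta map_polyC hornerC /= comp_polyC.
have N0 : \sum_i (c i)%:P%:P * N i = 0.
  apply: theta_inj => //.
    apply: (leq_trans (size_sum _ _ _)); apply/bigmax_leqP => i _.
    by rewrite mul_polyC (leq_trans (size_scale_leq _ _)) //; have [] := NH i.
  rewrite rmorph_sum -[RHS]cN; apply: eq_bigr => i _.
  by rewrite rmorphM /= tC mul_polyC.
rewrite mulr_suml -[RHS]add0r -[X in X + _]N0 -[RHS]big_split; apply: eq_bigr => i _ /=.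
by have [PE _ _ _] := NH i; rewrite [in LHS]PE [LHS]mulrDr mulrA.
Qed.

End Curve.

(** * Stepanov's upper bound for the rational points of the curve *)

Lemma pcharXnD (R : comNzRingType) p k (x y : R) : p \in [pchar R] ->
  (x + y) ^+ (p ^ k) = x ^+ (p ^ k) + y ^+ (p ^ k).
Proof.
by move=> pR; rewrite exprDn_pchar // pnatX (pnatE _ (pcharf_prime pR)) pR.
Qed.

Lemma pcharXn_sum (R : comNzRingType) p k (I : Type) (r : seq I) (P : pred I)
    (F : I -> R) : p \in [pchar R] ->
  (\sum_(i <- r | P i) F i) ^+ (p ^ k) = \sum_(i <- r | P i) F i ^+ (p ^ k).
Proof.
move=> pR; apply: (big_morph (fun x => x ^+ (p ^ k))) => [x y|]; first exact: pcharXnD.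
by rewrite expr0n expn_eq0 gtn_eqF // (prime_gt0 (pcharf_prime pR)).
Qed.

Lemma weight_le_sum (E : fieldType) p d w (I : finType) (F : I -> {poly {poly E}}) :
  (forall i, weight_le p d w (F i)) -> weight_le p d w (\sum_i F i).
Proof.
have w0 : weight_le p d w (0 : {poly {poly E}}) by move=> e; rewrite coef0 eqxx.
move=> wF; apply: (big_ind (weight_le p d w)) => // P Q wP wQ.
by rewrite -[Q]opprK -[- Q]sub0r; do 2?apply: weight_leB.
Qed.

Definition eval2 (E : comNzRingType) (x y : E) (P : {poly {poly E}}) : E :=
  (map_poly (horner_eval x) P).[y].

Lemma eval2B (E : comNzRingType) (x y : E) P Q :
  eval2 x y (P - Q) = eval2 x y P - eval2 x y Q.
Proof. by rewrite /eval2 rmorphB !hornerE. Qed.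

Lemma eval2M (E : comNzRingType) (x y : E) P Q :
  eval2 x y (P * Q) = eval2 x y P * eval2 x y Q.
Proof. by rewrite /eval2 rmorphM !hornerE. Qed.

Lemma eval2_sum (E : comNzRingType) (x y : E) (I : finType) (F : I -> {poly {poly E}}) :
  eval2 x y (\sum_i F i) = \sum_i eval2 x y (F i).
Proof. by rewrite /eval2 rmorph_sum horner_sum. Qed.

Lemma eval2_monom (E : comNzRingType) (x y : E) (g : {poly E}) e :
  eval2 x y (g%:P * 'X^e) = g.[x] * y ^+ e.
Proof. by rewrite /eval2 rmorphM /= map_polyXn map_polyC !hornerE. Qed.

Lemma eval2C (E : comNzRingType) (x y : E) (g : {poly E}) : eval2 x y g%:P = g.[x].
Proof. by rewrite /eval2 map_polyC hornerC. Qed.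

Lemma eval2_curve (E : fieldType) p (f : {poly E}) x y :
  eval2 x y (curve p f) = y ^+ p - y - f.[x].
Proof.
rewrite !eval2B eval2C -[in LHS](mul1r 'X^p) -[X in _ - eval2 _ _ X](mul1r 'X).
by rewrite -[X in _ - eval2 _ _ (_ * X)]expr1 !eval2_monom !hornerE.
Qed.

Section Count.

Variables (E : finFieldType) (p d k s sg : nat) (f : {poly E}).
Hypotheses (pE : p \in [pchar E]) (d_gt0 : (0 < d)%N) (p_d : coprime p d).
Hypotheses (f_size : size f = d.+1) (sE : s = (p ^ k)%N) (sgE : s = (p * sg)%N).
Hypotheses (card_E : #|E| = (s * s)%N) (sg_large : (d * d * p + 2 * d <= sg)%N).

(** An index (i, e, i', e') stands for x^(i + i' s) y^(e + e' s). The ranges of i and i' are unequal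
    so that p i + d e is at most s - p - d, hence a digit in base s, while the number of indices,
    s^2 - p^2 d^2, stays large. *)
Let idx := ((('I_(sg - d) * 'I_p) * ('I_(sg + d) * 'I_p))%type : finType).

Let monom_x (t : idx) : nat := (t.1.1 + t.2.1 * s)%N.
Let monom_y (t : idx) : nat := (t.1.2 + t.2.2 * s)%N.
Let weight (t : idx) : nat := (p * monom_x t + d * monom_y t)%N.

Let p_gt1 : (1 < p)%N := prime_gt1 (pcharf_prime pE).

Lemma low_weight i e : (i < sg - d)%N -> (e < p)%N -> (p * i + d * e + p + d <= s)%N.
Proof.
move=> im ep; rewrite sgE.
have [n sgn] : exists n, sg = (d + i + 1 + n)%N by exists (sg - d - i - 1)%N; lia.
have [m pm] : exists m, p = (e + 1 + m)%N by exists (p - e - 1)%N; lia.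
rewrite sgn pm; nia.
Qed.

Lemma weight_idx_inj : injective weight.
Proof.
move=> [[i e] [i' e']] [[j u] [j' u']]; rewrite /weight /monom_x /monom_y /= => H.
have hi := low_weight (ltn_ord i) (ltn_ord e); have hj := low_weight (ltn_ord j) (ltn_ord u).
set a := (p * i + d * e)%N in hi; set b := (p * j + d * u)%N in hj.
set a' := (p * i' + d * e')%N; set b' := (p * j' + d * u')%N.
have H' : (a' * s + a = b' * s + b)%N.
  by rewrite /a /a' /b /b'; move: H; rewrite !mulnDr !mulnDl !mulnA; lia.
have as_ : (a < s)%N by lia.
have bs : (b < s)%N by lia.
have s0 : (0 < s)%N by lia.
have ab : a = b by move/(congr1 (modn^~ s)): H'; rewrite !modnMDl !modn_small.
have ab' : a' = b'.
  by move/eqP: H'; rewrite ab eqn_add2r eqn_pmul2r // => /eqP.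
have [/val_inj-> /val_inj->] := weight_inj p_gt1 p_d (ltn_ord e) (ltn_ord u) ab.
by have [/val_inj-> /val_inj->] := weight_inj p_gt1 p_d (ltn_ord e') (ltn_ord u') ab'.
Qed.

Lemma high_weight i e : (i < sg + d)%N -> (e < p)%N -> (p * i + d * e + p + d <= s + 2 * p * d)%N.
Proof.
move=> im ep; rewrite sgE.
have [n sgn] : exists n, (sg + d = i + 1 + n)%N by exists (sg + d - i - 1)%N; lia.
have -> : (p * sg + 2 * p * d = p * (sg + d) + p * d)%N by rewrite mulnDr; ring.
have [m pm] : exists m, p = (e + 1 + m)%N by exists (p - e - 1)%N; lia.
rewrite sgn pm; nia.
Qed.

Lemma weight_bound t : (weight t <= s * s + 2 * p * d * s)%N.
Proof.
case: t => [[i e] [i' e']]; rewrite /weight /monom_x /monom_y /=.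
have := low_weight (ltn_ord i) (ltn_ord e); have := high_weight (ltn_ord i') (ltn_ord e').
set w := (p * i' + d * e')%N => h l.
have -> : (p * (i + i' * s) + d * (e + e' * s) = p * i + d * e + w * s)%N.
  by rewrite /w !mulnDr !mulnDl !mulnA; lia.
have : ((w + 1) * s <= (s + 2 * p * d) * s)%N by rewrite leq_mul2r; apply/orP; right; lia.
rewrite !mulnDl; lia.
Qed.

(** The weight bound is s^2 - (p + d - 1) s + 2 p d - p - d; for large [sg] its saving, linear in s,
    outweighs the p^2 d^2 missing from the number of unknowns. *)
Lemma card_idx :
  (((s - p - d) * s + (s + 2 * p * d - p - d)).+1 < #|{: idx}|)%N.
Proof.
rewrite !card_prod !card_ord sgE.
have [n sgn] : exists n, sg = (d * d * p + 2 * d + n)%N.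
  by exists (sg - (d * d * p + 2 * d))%N; lia.
have -> : ((sg - d) * p * ((sg + d) * p) = p * p * (sg * sg - d * d))%N.
  have -> : (sg * sg - d * d = (sg - d) * (sg + d))%N by rewrite !mulnn subn_sqr.
  by ring.
have h1 : (p + d <= p * sg)%N by nia.
have h2 : (d * d <= sg * sg)%N by apply: leq_mul; lia.
have h3 : (p * d + p * d * d * p + p * d < p * sg + d)%N by nia.
nia.
Qed.

Lemma weight_le_monomials (t : idx) :
  weight_le p d ((s - p - d) * s + (s + 2 * p * d - p - d))%N
    (('X^(t.1.1 * s + t.2.1) : {poly E})%:P * 'X^(t.1.2 * s + t.2.2)).
Proof.
apply: weight_le_monom; rewrite size_polyXn /=.
move: t => [[i e] [i' e']] /=.
have := low_weight (ltn_ord i) (ltn_ord e); have := high_weight (ltn_ord i') (ltn_ord e').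
set w := (p * i' + d * e')%N; set w' := (p * i + d * e)%N => h l.
apply: (@leq_trans (w' * s + w)%N).
  rewrite /w /w' mulnDl mulnDr -!mulnA.
  by rewrite !mulnDr; lia.
by apply: leq_add; [rewrite leq_mul2r; apply/orP; right|]; lia.
Qed.

(** The unknowns C t are chosen so that the sum of C t x^(i s + i') y^(e s + e') is zero on the
    curve. [F] carries the coefficients (C t)^s at x^(i + i' s) y^(e + e' s). At a rational point
    the power s^2 is the identity, so F^s takes the value of the former sum and F vanishes. Yet F is
    not zero on the curve, its monomials having distinct weights; so its pole order bounds the
    number of points. *)
Lemma curve_points_le :
  (p * #|[set x : E | [exists y : E, (y ^+ p - y == f.[x])%R]]| <= s * s + 2 * p * d * s)%N.
Proof.
set X := [set x | _].
have ss_exp (c : E) : (c ^+ s) ^+ s = c by rewrite -exprM -card_E expf_card.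
have p0 : (0 < p)%N by lia.
have s0 : (0 < s)%N by rewrite sE expn_gt0 p0.
have [alpha alphaP] : exists alpha : E, alpha ^+ p = lead_coef f.
  (* The power #|E| is the identity on [E], so this is a p-th root. *)
  exists (lead_coef f ^+ (#|E| %/ p)).
  by rewrite -exprM divnK ?expf_card // card_E sgE -mulnA dvdn_mulr.
have alpha0 : alpha != 0.
  apply: contra_eq_neq alphaP => ->; rewrite expr0n gtn_eqF // eq_sym lead_coef_eq0.
  by rewrite -size_poly_gt0 f_size.
have [C [[t0 Ct0] [H CH]]] := @curve_dependent _ _ _ _ _ p_gt1 d_gt0 p_d f_size alphaP
  idx (fun t => ('X^(t.1.1 * s + t.2.1))%:P * 'X^(t.1.2 * s + t.2.2)) _ alpha0
  weight_le_monomials card_idx.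
pose m (t : idx) : {poly {poly E}} := (C t ^+ s *: 'X^(monom_x t))%:P * 'X^(monom_y t).
pose F := \sum_t m t.
have [tmax Ctmax tmaxP] : exists2 t, C t != 0 & forall t', C t' != 0 -> (weight t' <= weight t)%N.
  by case: (@arg_maxnP _ t0 (fun t => C t != 0) weight Ct0) => t Ct tP; exists t.
pose w := weight tmax.
have wF : weight_le p d w F.
  apply: weight_le_sum => t; have [C0|C0] := eqVneq (C t) 0.
    by move=> e; rewrite /m C0 expr0n gtn_eqF // scale0r mul0r coef0 eqxx.
  apply: weight_le_monom; apply: leq_trans (tmaxP _ C0).
  by rewrite size_scale ?expf_neq0 // size_polyXn.
have coef_m t : (theta p d alpha (m t))`_w = (weight t == w)%:R * (C t ^+ s * alpha ^+ monom_y t).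
  rewrite theta_monom comp_polyZ rmorphXn /= comp_polyX -exprM -scalerAl -exprD.
  by rewrite scalerA coefZ coefXn mulrC eq_sym [alpha ^+ _ * _]mulrC.
have coefF : (theta p d alpha F)`_w != 0.
  rewrite rmorph_sum coef_sum (bigD1 tmax) //= coef_m eqxx mul1r big1 ?addr0.
    by rewrite mulf_neq0 ?expf_neq0.
  move=> t tt; rewrite coef_m; case: eqP => [/weight_idx_inj ttE|_]; last by rewrite mul0r.
  by rewrite ttE eqxx in tt.
have [N [G [FN sN wN tN]]] := curve_normal_form p_gt1 d_gt0 p_d f_size alphaP wF.
have N0 : N != 0.
  apply: contraTneq tN => ->; rewrite rmorph0 subr0 -ltnNge.
  by rewrite ltnNge; apply: contra coefF => /leq_sizeP ->.
have FX x y : y ^+ p - y = f.[x] -> eval2 x y F = 0.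
  move=> yx; suff : eval2 x y F ^+ s == 0 by rewrite expf_eq0 s0 => /eqP.
  have -> : eval2 x y F ^+ s = eval2 x y (H * curve p f).
    rewrite -CH !eval2_sum {1}sE pcharXn_sum // -sE; apply: eq_bigr => t _.
    rewrite [RHS]eval2M [in RHS]eval2C hornerC /m !eval2_monom !hornerZ !hornerXn !exprMn ss_exp.
    rewrite -!exprM -mulrA /monom_x /monom_y !mulnDl -!mulnA -card_E !exprD.
    by rewrite ![(_ * #|E|)%N]mulnC !(exprM _ #|E|) !expf_card !mulrA.
  by rewrite eval2M eval2_curve yx subrr mulr0.
have NX x y : y ^+ p - y = f.[x] -> eval2 x y N = 0.
  move=> yx; have := FX x y yx; rewrite FN -[G * _]opprK -/(_ - _) eval2B -mulNr eval2M.
  by rewrite eval2_curve yx subrr mulr0 subr0.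
(* Over x in [X] the [p] values y + i all lie on the curve, more than the y-degree of [N] allows;
   hence every coefficient of [N] vanishes at x. *)
have N_root x : x \in X -> map_poly (horner_eval x) N = 0.
  rewrite inE => /existsP[y /eqP yx].
  apply: (@roots_geq_poly_eq0 _ _ [seq y + (nat_of_ord i)%:R | i <- enum 'I_p]).
  - apply/allP => z /mapP[i _ ->]; apply/rootP; apply: NX.
    rewrite -yx; have := pcharXnD 1 y i%:R pE; rewrite expn1 => ->.
    rewrite -(pFrobenius_autE pE i%:R) pFrobenius_aut_nat.
    by ring.
  - rewrite map_inj_uniq ?enum_uniq // => i j /addrI/eqP.
    rewrite -subr_eq0; wlog ij : i j / (i <= j)%N => [W|].
      by have [/W|/ltnW/W] := leqP i j; [exact|rewrite -opprB oppr_eq0 => W' /W'->].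
    rewrite -opprB oppr_eq0 -natrB // -(dvdn_pcharf pE) => /dvdnP[[|n] ji].
      by apply/val_inj/eqP; rewrite /= eqn_leq ij -subn_eq0 ji.
    by have := ltn_ord j; lia.
  - rewrite size_map size_enum_ord; apply: leq_trans sN.
    exact: size_poly.
have [e Ne] : exists e, N`_e != 0 by exists (size N).-1; rewrite -lead_coefE lead_coef_eq0.
have Xe : (#|X| <= (size (N`_e)%R).-1)%N.
  rewrite -ltnS prednK ?size_poly_gt0 // cardE; apply: max_poly_roots (enum_uniq _) => //.
  apply/allP => x; rewrite mem_enum => /N_root Nx; apply/rootP.
  by rewrite -[LHS]/(horner_eval x N`_e) -coef_map Nx coef0.
apply: (leq_trans _ (weight_bound tmax)); apply: leq_trans (wN _ Ne).
by rewrite (leq_trans _ (leq_addr _ _)) // leq_mul2l Xe orbT.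
Qed.

End Count.

(** * Additive characters *)

Definition add_char (V : zmodType) (psi : V -> algC) :=
  psi 0 = 1 /\ {morph psi : x y / x + y >-> x * y}.

Section AdditiveCharacter.

Variables (F : finFieldType) (psi : F -> algC).
Hypothesis psiP : add_char psi.

Lemma add_charN x : psi x * psi (- x) = 1.
Proof. by rewrite -(psiP.2) subrr psiP.1. Qed.

Lemma add_charMn x n : psi (x *+ n) = psi x ^+ n.
Proof.
by elim: n => [|n IHn]; rewrite ?mulr0n ?psiP.1 // mulrS psiP.2 IHn exprS.
Qed.

Lemma norm_add_char x : `|psi x| = 1.
Proof.
have [p p_pr pF] := finPcharP F.
apply/eqP; rewrite -(@pexpr_eq1 _ _ p) ?prime_gt0 // -normrX -add_charMn.
by rewrite (mulrn_pchar pF) psiP.1 normr1.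
Qed.

Lemma sum_add_char a : psi a != 1 -> \sum_x psi x = 0.
Proof.
move=> a1; apply/eqP; have : (1 - psi a) * \sum_x psi x == 0.
  rewrite mulrBl mul1r mulr_sumr {1}(reindex_inj (addrI a)) /= -sumrB big1 // => x _.
  by rewrite psiP.2 subrr.
by rewrite mulf_eq0 subr_eq0 eq_sym (negPf a1).
Qed.

(* If all these characters of y were nontrivial for gamma != 0, summing           *)
(* psi (gamma (y ^ p - y)) over y first would give #|F|, whereas summing over     *)
(* gamma first gives #|F| times the number of roots of 'X^p - 'X.                 *)
Lemma exists_twist p a : p \in [pchar F] -> psi a != 1 ->
  exists2 gamma, gamma != 0 & forall y, psi (gamma * (y ^+ p - y)) = 1.
Proof.
move=> pF a1; pose P gamma := [forall y, psi (gamma * (y ^+ p - y)) == 1].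
case: (pickP [pred gamma | (gamma != 0) && P gamma]) => [g /andP[g0 /forallP Pg]|noP].
  by exists g => // y; apply/eqP.
have sum0 gamma : gamma != 0 -> \sum_y psi (gamma * (y ^+ p - y)) = 0.
  move=> g0; have := noP gamma; rewrite /= g0 /= => /negbT; rewrite negb_forall.
  case/existsP=> b b1; apply/eqP.
  have : (1 - psi (gamma * (b ^+ p - b))) * \sum_y psi (gamma * (y ^+ p - y)) == 0.
    rewrite mulrBl mul1r mulr_sumr {1}(reindex_inj (addrI b)) /= -sumrB big1 // => y _.
    have := pcharXnD 1 b y pF; rewrite expn1 => ->.
    by rewrite opprD addrACA mulrDr psiP.2 subrr.
  by rewrite mulf_eq0 subr_eq0 eq_sym (negPf b1).
have : \sum_g \sum_y psi (g * (y ^+ p - y)) = \sum_(y : F) (#|F| * (y ^+ p == y))%:R.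
  rewrite exchange_big; apply: eq_bigr => y _ /=.
  have [->|yp] := eqVneq (y ^+ p) y.
    under eq_bigr do rewrite subrr mulr0 psiP.1.
    by rewrite sumr_const muln1.
  rewrite muln0 -[RHS](sum_add_char a1) [RHS](reindex_inj (mulIf (x := y ^+ p - y) _)) //.
  by rewrite subr_eq0.
rewrite (bigD1 0) //= [X in _ + X]big1 ?addr0; last by move=> g /sum0.
under eq_bigr do rewrite mul0r psiP.1.
rewrite sumr_const -natr_sum => /eqP; rewrite eqr_nat => /eqP.
have p0 : (0 < p)%N by rewrite prime_gt0 // (pcharf_prime pF).
rewrite (bigD1 0) //= (bigD1 1) ?oner_eq0 //= expr1n expr0n gtn_eqF //= !eqxx !muln1.
have : (0 < #|F|)%N by apply/card_gt0P; exists 0.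
by set n := #|_|; lia.
Qed.

End AdditiveCharacter.

(** * From point counts to a character sum *)

Section StepanovSum.

Variables (E : finFieldType) (p d k s sg : nat) (f : {poly E}).
Hypotheses (pE : p \in [pchar E]) (d_gt0 : (0 < d)%N) (p_d : coprime p d).
Hypotheses (f_size : size f = d.+1) (sE : s = (p ^ k)%N) (sgE : s = (p * sg)%N).
Hypotheses (card_E : #|E| = (s * s)%N) (sg_large : (d * d * p + 2 * d <= sg)%N).

Variables (psi : E -> algC) (a : E).
Hypotheses (psiP : add_char psi) (psi_a : psi a != 1).
Hypothesis psi_pX : forall y, psi (y ^+ p - y) = 1.

Let fiber delta : {set E * E} := [set t | t.2 ^+ p - t.2 == f.[t.1] - delta].

Lemma card_fiber_le delta : (#|fiber delta| <= s * s + 2 * p * d * s)%N.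
Proof.
have f_size' : size (f - delta%:P) = d.+1.
  rewrite size_polyDl ?f_size // size_polyN ltnS (leq_trans (size_polyC_leq1 _)) //.
apply: leq_trans (curve_points_le pE d_gt0 p_d f_size' sE sgE card_E sg_large).
set X := [set x | _].
rewrite -sum1_card (partition_big (fun t : E * E => t.1) (mem X)) /=; last first.
  move=> [x y]; rewrite !inE /= => /eqP xy; apply/existsP; exists y.
  by rewrite xy !hornerE.
rewrite mulnC -sum_nat_const; apply: leq_sum => x _.
rewrite sum1_card; pose g := 'X^p - 'X - (f.[x] - delta)%:P : {poly E}.
have p_gt1 : (1 < p)%N by apply/prime_gt1/(pcharf_prime pE).
have size_g : size g = p.+1.
  rewrite /g -addrA size_polyDl size_polyXn // ltnS -opprD size_polyN.
  by rewrite (leq_trans (size_polyD _ _)) // size_polyX geq_max p_gt1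
             (leq_trans (size_polyC_leq1 _)) // ltnW.
rewrite -ltnS -size_g.
have g0 : g != 0 by rewrite -size_poly_gt0 size_g.
rewrite cardE -(size_map (fun t : E * E => t.2)).
apply: max_poly_roots g0 _ _.
  apply/allP => y /mapP[[x' y']]; rewrite mem_enum unfold_in inE /= => /andP[/eqP xy /eqP xx] ->.
  by rewrite rootE !hornerE xy xx subrr.
rewrite map_inj_in_uniq ?enum_uniq // => -[x1 y1] [x2 y2]; rewrite !mem_enum.
by rewrite !unfold_in => /andP[_ /eqP/= ->] /andP[_ /eqP/= ->] /= ->.
Qed.

(** As [psi] is trivial on y^p - y, the sum of [psi delta] weighted by fiber sizes is #|E| S. Since
    [psi] sums to 0, each fiber size may be replaced, up to sign, by its defect from the upper bound
    [B]. Defects are nonnegative, so the norm is at most their total #|E| (B - #|E|). *)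
Lemma stepanov_sum : `|\sum_x psi f.[x]| <= (2 * p * d * s)%:R.
Proof.
pose B := (s * s + 2 * p * d * s)%N; set S := \sum_x _.
have Q0 : (0 < #|E|)%N by apply/card_gt0P; exists 0.
have fiberE (G : E -> algC) :
    \sum_delta G delta *+ #|fiber delta| = \sum_x \sum_y G (f.[x] - (y ^+ p - y)).
  rewrite pair_big /= (partition_big (fun t => f.[t.1] - (t.2 ^+ p - t.2)) xpredT) //=.
  apply: eq_bigr => delta _; rewrite -sumr_const.
  have tE t : (t \in fiber delta) = (f.[t.1] - (t.2 ^+ p - t.2) == delta).
    by rewrite inE; apply/eqP/eqP => [->|<-]; rewrite subKr.
  by apply: eq_big => [t|t]; rewrite tE // => /eqP ->.
have sumS : \sum_delta psi delta *+ #|fiber delta| = #|E|%:R * S.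
  rewrite fiberE mulr_sumr; apply: eq_bigr => x _; rewrite mulr_natl -sumr_const.
  apply: eq_bigr => y _; rewrite psiP.2 -[RHS]mulr1; congr (_ * _).
  by rewrite -[LHS]mul1r -(psi_pX y) (add_charN psiP).
have sum1 : \sum_delta (1 : algC) *+ #|fiber delta| = #|E|%:R * #|E|%:R.
  rewrite (fiberE (fun=> 1)) mulr_natl -sumr_const.
  by apply: eq_bigr => x _; rewrite sumr_const.
have : #|E|%:R * `|S| <= #|E|%:R * (2 * p * d * s)%:R.
  rewrite -[X in X * `|_|]normr_nat -normrM -sumS -normrN.
  have -> : - (\sum_delta psi delta *+ #|fiber delta|)
      = \sum_delta psi delta * (B%:R - #|fiber delta|%:R).
    under [RHS]eq_bigr do rewrite mulrBr.
    under [in LHS]eq_bigr do rewrite -mulr_natr.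
    by rewrite sumrB -mulr_suml (sum_add_char psiP psi_a) mul0r sub0r.
  apply: (le_trans (ler_norm_sum _ _ _)).
  have -> : #|E|%:R * (2 * p * d * s)%:R = \sum_delta (B%:R - 1 *+ #|fiber delta|) :> algC.
    rewrite sumrB sum1 sumr_const -[B%:R *+ _]mulr_natl -mulrBr; congr (_ * _).
    by rewrite card_E /B natrD addrAC subrr add0r.
  apply: ler_sum => delta _; rewrite normrM (norm_add_char psiP) mul1r.
  by rewrite ger0_norm // subr_ge0 ler_nat card_fiber_le.
by rewrite ler_pM2l // ltr0n.
Qed.

End StepanovSum.

(** * The L-function *)

Section MonicOf.

Variable F : fieldType.

Definition monic_of m (v : 'rV[F]_m) : {poly F} := 'X^m + rVpoly v.

Lemma size_rVpoly m (v : 'rV[F]_m) : (size (rVpoly v) <= m)%N.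
Proof. exact: size_poly. Qed.

Lemma size_monic_of m (v : 'rV[F]_m) : size (monic_of v) = m.+1.
Proof. by rewrite size_polyDl size_polyXn // ltnS size_rVpoly. Qed.

Lemma monic_of_monic m (v : 'rV[F]_m) : monic_of v \is monic.
Proof.
by rewrite monicE lead_coefDl ?lead_coefXn // size_polyXn ltnS size_rVpoly.
Qed.

Lemma monic_ofK m : cancel (@monic_of m) poly_rV.
Proof.
move=> v; rewrite /monic_of linearD /= rVpolyK.
rewrite -[RHS]add0r; congr (_ + _); apply/rowP => i.
by rewrite !mxE coefXn ltn_eqF.
Qed.

Lemma poly_rVK_monic m (g : {poly F}) : g \is monic -> size g = m.+1 ->
  monic_of (poly_rV g : 'rV_m) = g.
Proof.
move=> g_mon g_size; apply/polyP => i; rewrite coefD coefXn coef_rVpoly.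
case: insubP => [j jm ji|]; first by rewrite mxE ji (ltn_eqF jm) add0r.
rewrite -leqNgt leq_eqVlt => /orP[/eqP<-|mi].
  by have := monicP g_mon; rewrite lead_coefE g_size eqxx addr0 => ->.
by rewrite gtn_eqF // addr0 nth_default ?g_size.
Qed.

Lemma monic_of_add m (v : 'rV[F]_m) c (i : 'I_m) :
  monic_of (v + c *: delta_mx 0 i) = monic_of v + c *: 'X^i.
Proof. by rewrite /monic_of linearD linearZ /= rVpoly_delta addrA. Qed.

End MonicOf.

Lemma coefM_top (R : nzRingType) (a b : {poly R}) i j :
  (size a <= i.+1)%N -> (size b <= j.+1)%N -> (a * b)`_(i + j) = a`_i * b`_j.
Proof.
move=> ai bj; have ij : (i < (i + j).+1)%N by rewrite ltnS leq_addr.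
rewrite coefM (bigD1 (Ordinal ij)) //= addKn big1 ?addr0 // => k ki.
have [ik|ik] := ltnP i k; first by rewrite [a`_k]nth_default ?mul0r // (leq_trans ai).
rewrite [b`__]nth_default ?mulr0 // (leq_trans bj) // ltn_subRL.
by have : (k : nat) != i by []; lia.
Qed.

Lemma size_polyM_le (R : nzRingType) (a b : {poly R}) i j :
  (size a <= i)%N -> (size b <= j)%N -> (size (a * b)%R <= (i + j).-1)%N.
Proof.
move=> ai bj; apply: leq_trans (size_polyMleq _ _) _.
by rewrite -!subn1 leq_sub2r // leq_add.
Qed.

Section Residue.

Variable F : fieldType.

(* The sum of f over the roots of the monic polynomial g, with multiplicity: it  *)
(* is the residue at infinity of f g' / g.                                       *)
Definition residue (f g : {poly F}) : F := (f * g^`() %% g)`_(size g).-2.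

Lemma residue1 f : residue f 1 = 0.
Proof. by rewrite /residue modp1 coef0. Qed.

Lemma residue_XsubC f a : residue f ('X - a%:P) = f.[a].
Proof. by rewrite /residue derivXsubC mulr1 modp_XsubC size_XsubC coefC. Qed.

Lemma monic_le1 (g : {poly F}) : g \is monic -> (size g <= 1)%N -> g = 1.
Proof.
by move=> gm /size1_polyC gE; move: gm; rewrite gE monicE lead_coefC => /eqP ->.
Qed.

(** Since (g h)' = g' h + g h', the remainder for g h is r h + r' g, and g and h being monic, top
    coefficients add. *)
Lemma residueM f g h : g \is monic -> h \is monic ->
  residue f (g * h) = residue f g + residue f h.
Proof.
wlog [gs hs] : g h / (1 < size g)%N /\ (1 < size h)%N => [W gm hm|gm hm].
  have [g1|g1] := leqP (size g) 1.
    by rewrite (monic_le1 gm g1) mul1r residue1 add0r.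
  have [h1|h1] := leqP (size h) 1.
    by rewrite (monic_le1 hm h1) mulr1 residue1 addr0.
  exact: W.
have g0 := monic_neq0 gm; have h0 := monic_neq0 hm.
rewrite /residue size_mul //; set r := f * g^`() %% g; set r' := f * h^`() %% h.
have rs : (size r < size g)%N by rewrite ltn_modp.
have rs' : (size r' < size h)%N by rewrite ltn_modp.
have [m gE] : exists m, size g = m.+2 by exists (size g).-2; lia.
have [n hE] : exists n, size h = n.+2 by exists (size h).-2; lia.
have <- : r * h + r' * g = f * (g * h)^`() %% (g * h).
  apply: (modpP (q := f * g^`() %/ g + f * h^`() %/ h)).
    rewrite derivM mulrDr !mulrA {1}(divp_eq (f * g^`()) g) -/r.
    rewrite (mulrAC f g) {1}(divp_eq (f * h^`()) h) -/r'; ring.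
  rewrite size_mul // gE hE addSn /= (leq_ltn_trans (size_polyD _ _)) // gtn_max.
  have rs1 : (size r <= m.+1)%N by rewrite -ltnS -gE.
  have rs2 : (size r' <= n.+1)%N by rewrite -ltnS -hE.
  apply/andP; split.
    by apply: leq_ltn_trans (size_polyM_le rs1 (eq_leq hE)) _; lia.
  by apply: leq_ltn_trans (size_polyM_le rs2 (eq_leq gE)) _; lia.
rewrite gE hE coefD (_ : _.-1.-2 = m + n.+1)%N; last by lia.
rewrite coefM_top ?hE //; last by rewrite -ltnS -gE.
rewrite addnC addSnnS coefM_top ?gE //; last by rewrite -ltnS -hE.
have -> : h`_n.+1 = 1 by have := monicP hm; rewrite lead_coefE hE.
have -> : g`_m.+1 = 1 by have := monicP gm; rewrite lead_coefE gE.
by rewrite !mulr1.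
Qed.

Lemma residue_prod f (I : Type) (s : seq I) (g : I -> {poly F}) :
  (forall i, g i \is monic) -> residue f (\prod_(i <- s) g i) = \sum_(i <- s) residue f (g i).
Proof.
move=> gm; elim: s => [|i s IHs]; first by rewrite !big_nil residue1.
by rewrite !big_cons residueM ?IHs // monic_prod.
Qed.

Lemma residueXn f g n : g \is monic -> residue f (g ^+ n) = residue f g *+ n.
Proof.
move=> gm; elim: n => [|n IHn]; first by rewrite residue1.
by rewrite exprS residueM ?monic_exp // IHn mulrS.
Qed.

(** The coefficient of X^(m - d) enters the d-th power sum of the roots linearly, with factor -d,
    and no lower positive one. In the division below the quotient [u] is unchanged, and the top
    coefficient of the remainder moves by c [lead_coef f] times (m - d) - m. *)
Lemma residue_shift (f g : {poly F}) c m d : (0 < d)%N -> size f = d.+1 -> (d <= m)%N ->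
    g \is monic -> size g = m.+1 ->
  residue f (g + c *: 'X^(m - d)) = residue f g - (c * lead_coef f) *+ d.
Proof.
move=> d0 fd dm gm gs; set g1 := g + _.
have g1s : size g1 = m.+1.
  by rewrite size_polyDl // (leq_ltn_trans (size_scale_leq _ _)) // size_polyXn gs; lia.
rewrite /residue g1s gs; set u := f * g^`() %/ g; set r := f * g^`() %% g.
have uE : f * g^`() = u * g + r by apply: divp_eq.
have g_neq0 := monic_neq0 gm.
have rs : (size r <= m)%N by rewrite -ltnS -gs ltn_modp.
have g's : (size g^`() <= m)%N by rewrite -ltnS -gs lt_size_deriv.
have f_neq0 : f != 0 by rewrite -size_poly_gt0 fd.
have us : (size u <= d)%N.
  rewrite size_divp // gs /= leq_subLR (leq_trans (size_polyMleq _ _)) // fd; lia.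
have [k mE] : exists k, m = k.+1 by exists m.-1; lia.
have [e dE] : exists e, d = e.+1 by exists d.-1; lia.
have g_top : g`_m = 1 by have := monicP gm; rewrite lead_coefE gs.
have u_top : u`_e = lead_coef f *+ m.
  have := congr1 (fun P : {poly F} => P`_(d + k)) uE.
  rewrite coefM_top ?fd // -?mE // coef_deriv -mE g_top mulr_natr lead_coefE fd => ->.
  rewrite coefD [r`__]nth_default ?addr0; last by apply: leq_trans rs _; lia.
  by rewrite dE addSnnS -mE coefM_top -?dE // ?gs // g_top mulr1.
have <- : r - c *: (u * 'X^(m - d)) + c *: (f * 'X^((m - d).-1)) *+ (m - d) = f * g1^`() %% g1.
  apply: (modpP (q := u)).
    have alg (A B D U V G h : {poly F}) n :
      U * G + V + h * (D * (B *+ n)) = U * (G + D * A) + (V - D * (U * A) + (D * (h * B)) *+ n).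
      by ring.
    rewrite /g1 derivD derivZ derivXn mulrDr uE -!mul_polyC; exact: alg.
  rewrite g1s ltnS (leq_trans (size_polyD _ _)) // geq_max; apply/andP; split.
    rewrite (leq_trans (size_polyD _ _)) // geq_max rs size_polyN /=.
    rewrite (leq_trans (size_scale_leq _ _)) //.
    by apply: leq_trans (size_polyM_le us (eq_leq (size_polyXn _ _))) _; lia.
  have [->|md] := eqVneq (m - d)%N 0%N; first by rewrite mulr0n size_poly0.
  rewrite -scaler_nat (leq_trans (size_scale_leq _ _)) // (leq_trans (size_scale_leq _ _)) //.
  by rewrite (leq_trans (size_polyMleq _ _)) // size_polyXn fd; lia.
rewrite !coefD coefN coefZ mE /= -[LHS]addrA; congr (_ + _).
have -> : (u * 'X^(k.+1 - d) : {poly F})`_k = lead_coef f *+ m.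
  by rewrite coefMXn ifF; [rewrite -u_top; congr (u`__); lia|lia].
have -> : (c *: (f * 'X^((k.+1 - d).-1)) *+ (k.+1 - d) : {poly F})`_k = (c * lead_coef f) *+ (m - d).
  rewrite coefMn coefZ mE; have [->|md] := eqVneq (k.+1 - d)%N 0%N; first by rewrite !mulr0n.
  rewrite coefMXn ifF ?lead_coefE ?fd; [|lia].
  by congr (_ * f`__ *+ _); lia.
rewrite mulrnAr mulrnBr //; ring.
Qed.

End Residue.

Lemma residue_map (F E : fieldType) (iota : {rmorphism F -> E}) f g :
  residue (map_poly iota f) (map_poly iota g) = iota (residue f g).
Proof.
by rewrite /residue size_map_poly deriv_map -rmorphM -map_modp coef_map.
Qed.

(** * Multiplicities of irreducible factors *)

Section Multiplicity.

Variable F : finFieldType.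
Implicit Types (P g h : {poly F}).

Lemma exists_monic_irreducible_factor g : (1 < size g)%N ->
  exists P, [/\ P \is monic, irreducible_poly P & P %| g].
Proof.
have [n] := ubnP (size g); elim: n g => // n IHn g gn g1.
have [/irreducibleP gi|gi] := boolP (irreducibleb g).
  have g0 : g != 0 by rewrite -size_poly_gt0 ltnW.
  have lc : (lead_coef g)^-1 != 0 by rewrite invr_eq0 lead_coef_eq0.
  exists ((lead_coef g)^-1 *: g); split.
  - by rewrite monicE lead_coefZ mulVf ?lead_coef_eq0.
  - split=> [|q q1]; first by rewrite size_scale.
    rewrite dvdpZr // => /gi.2-/(_ q1) qg; apply: eqp_trans qg _.
    by rewrite eqp_sym eqp_scale.
  - by rewrite dvdpZl.
have [q [qg q1 qs]] : exists q, [/\ q %| g, (1 < size q)%N & (size q < size g)%N].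
  move: gi; rewrite /irreducibleb g1 negb_forall => /existsP[q].
  rewrite negb_imply -ltnNge -Pdiv.Idomain.dvdpE => /andP[qg q1].
  by exists q; split=> //; have := size_npoly q; rewrite -ltnS prednK // ltnW.
have [|//|P [Pm Pi Pq]] := IHn q; first exact: leq_trans qs _.
by exists P; split=> //; apply: dvdp_trans qg.
Qed.

Lemma irreducible_dvd_coprime P Q : P \is monic -> Q \is monic ->
  irreducible_poly P -> irreducible_poly Q -> P != Q -> coprimep P Q.
Proof.
move=> Pm Qm Pi Qi; apply: contraNT => PQ.
have [_ /(_ _ PQ (dvdp_gcdl _ _)) gP] := Pi; have [_ /(_ _ PQ (dvdp_gcdr _ _)) gQ] := Qi.
by rewrite -eqp_monic // (eqp_trans _ gQ) // eqp_sym.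
Qed.

Lemma size_exp_gt P n : (1 < size P)%N -> (n < size (P ^+ n)%R)%N.
Proof.
move=> P1; have P0 : P != 0 by rewrite -size_poly_gt0 ltnW.
rewrite -[size _]prednK ?size_poly_gt0 ?expf_neq0 // size_exp ltnS leq_pmull //.
by rewrite -ltnS prednK // ltnW.
Qed.

(** For irreducible [P] this is the multiplicity of [P] in a nonzero [g], once [M] is at least the
    degree of [g]. *)
Definition mult_count M P g : nat := (\sum_(j < M) (P ^+ j.+1 %| g)%R)%N.

Lemma mult_countM M P Q g : P \is monic -> Q \is monic -> irreducible_poly P ->
    irreducible_poly Q -> g != 0 -> (size g <= M)%N ->
  mult_count M P (Q * g) = (mult_count M P g + (P == Q))%N.
Proof.
move=> Pm Qm Pi Qi g0 gM; have [<-|PQ] := eqVneq P Q; last first.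
  rewrite addn0; apply: eq_bigr => j _; rewrite Gauss_dvdpr //.
  by rewrite coprimep_expl // irreducible_dvd_coprime.
case: M gM => [|M gM]; first by rewrite leqn0 size_poly_eq0 (negPf g0).
rewrite /mult_count big_ord_recl [in RHS]big_ord_recr /=.
have P0 := monic_neq0 Pm.
have -> : (P ^+ M.+1 %| g) = false.
  apply: contraTF (size_exp_gt M.+1 Pi.1) => /(dvdp_leq g0) PM.
  by rewrite -leqNgt (leq_trans PM).
rewrite addn0 expr1 dvdp_mulr // addnC; congr (_ + _)%N; apply: eq_bigr => j _.
by rewrite /bump /= exprS dvdp_mul2l.
Qed.

Lemma sum_mult_count M g : g \is monic -> (size g <= M.+1)%N ->
  (\sum_(e < M.+1) \sum_(v : 'rV[F]_e | irreducibleb (monic_of v))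
     e * mult_count M.+1 (monic_of v) g = (size g).-1)%N.
Proof.
have [n] := ubnP (size g); elim: n g => // n IHn g gn gm gM.
have [g1|g1] := leqP (size g) 1.
  rewrite (monic_le1 gm g1) size_poly1 big1 // => e _; rewrite big1 // => v /irreducibleP[v1 _].
  rewrite [mult_count _ _ _]big1 ?muln0 // => j _; rewrite dvdp1.
  apply/eqP; rewrite eqb0; apply: contraL (size_exp_gt j.+1 v1) => /eqP ->.
  by rewrite ltnS.
have [P [Pm Pi /dvdpP[h gE]]] := exists_monic_irreducible_factor g1.
have hm : h \is monic by rewrite -(monicMr _ Pm) -gE.
have h0 := monic_neq0 hm; have P0 := monic_neq0 Pm.
have [P1 _] := Pi; pose e0 := (size P).-1.
have sg : (size g).-1 = ((size h).-1 + e0)%N.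
  have : (0 < size h)%N by rewrite size_poly_gt0.
  by rewrite gE size_mul // /e0; move: P1; case: (size P) => // k; case: (size h) => // l; lia.
have hg : (size h < size g)%N.
  have : (0 < size h)%N by rewrite size_poly_gt0.
  by move: sg g1 P1; rewrite /e0; case: (size P) (size h) (size g) => [|a] [|b] [|c] //=; lia.
have e0M : (e0 < M.+1)%N.
  by move: sg g1 gM; case: (size g) => // c /= -> _; rewrite ltnS; lia.
transitivity (\sum_(e < M.+1) \sum_(v : 'rV[F]_e | irreducibleb (monic_of v))
     (e * mult_count M.+1 (monic_of v) h + e * (monic_of v == P)))%N.
  apply: eq_bigr => e _; apply: eq_bigr => v /irreducibleP vi.
  rewrite gE mulrC mult_countM ?monic_of_monic // ?mulnDr //.
  by rewrite (leq_trans (ltnW hg)).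
under eq_bigr do rewrite big_split /=; rewrite big_split /= IHn //; last 2 first.
- by rewrite (leq_trans hg).
- by rewrite (leq_trans (ltnW hg)).
rewrite sg; congr (_ + _)%N.
have sP : size P = e0.+1 by rewrite /e0 prednK // ltnW.
rewrite (bigD1 (Ordinal e0M)) //= [X in (_ + X)%N]big1 ?addn0 => [|e ne]; last first.
  rewrite big1 // => v _; case: eqP => [vP|]; last by rewrite muln0.
  case/eqP: ne; apply/val_inj => /=; apply/eqP; rewrite -eqSS -sP -vP.
  by rewrite size_monic_of.
rewrite (bigD1 (poly_rV P)) /=; last by apply/irreducibleP; rewrite poly_rVK_monic.
rewrite poly_rVK_monic // eqxx muln1 big1 ?addn0 // => v /andP[_ vP].
by case: eqP => [vE|]; rewrite ?muln0 //; case/eqP: vP; rewrite -(monic_ofK v) vE.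
Qed.

Lemma sum_monic_dvd (R : nmodType) m k h (G : {poly F} -> R) :
    h \is monic -> size h = k.+1 ->
  \sum_(v : 'rV[F]_m | h %| monic_of v) G (monic_of v) =
  if (k <= m)%N then \sum_(w : 'rV[F]_(m - k)) G (h * monic_of w) else 0.
Proof.
move=> hm hs; have h0 := monic_neq0 hm.
case: leqP => km; last first.
  rewrite big1 // => v /(dvdp_leq (monic_neq0 (monic_of_monic v))).
  by rewrite hs size_monic_of; lia.
have hw (w : 'rV[F]_(m - k)) :
    (h * monic_of w \is monic) * (size (h * monic_of w) = m.+1).
  split; first by rewrite monicMl ?monic_of_monic.
  by rewrite size_monicM ?monic_neq0 ?monic_of_monic // hs size_monic_of; lia.
rewrite (reindex_onto (fun w : 'rV[F]_(m - k) => poly_rV (h * monic_of w))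
  (fun v => poly_rV (monic_of v %/ h))) /=.
  apply: eq_big => [w|w _]; rewrite poly_rVK_monic ?hw //.
  by rewrite dvdp_mulr // mulKp // monic_ofK eqxx.
move=> v hv; have vE := divpK hv; rewrite mulrC in vE.
have vm := monic_of_monic v.
have qm : monic_of v %/ h \is monic by rewrite -(monicMl _ hm) vE.
rewrite poly_rVK_monic ?vE ?monic_ofK //.
by rewrite size_divp // size_monic_of hs /= subSn.
Qed.

End Multiplicity.

(** * Euler product and logarithmic derivative *)

Section LFunction.

Variables (F : finFieldType) (psi : F -> algC) (f : {poly F}).
Hypothesis psiP : add_char psi.

Definition Lchar (g : {poly F}) : algC := psi (residue f g).

Definition Lcoef m : algC := \sum_(v : 'rV[F]_m) Lchar (monic_of v).

(** The coefficient of T^k in T L'(T) / L(T), where L is the series with coefficients [Lcoef]; an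
    analogue of the von Mangoldt function. *)
Definition Lpower k : algC :=
  \sum_(e < k.+1 | (e %| k)%N)
    (\sum_(v : 'rV[F]_e | irreducibleb (monic_of v)) Lchar (monic_of v) ^+ (k %/ e)) *+ e.

Lemma LcharM g h : g \is monic -> h \is monic -> Lchar (g * h) = Lchar g * Lchar h.
Proof. by move=> gm hm; rewrite /Lchar residueM // psiP.2. Qed.

Lemma LcharXn g n : g \is monic -> Lchar (g ^+ n) = Lchar g ^+ n.
Proof. by move=> gm; rewrite /Lchar residueXn // add_charMn. Qed.

Lemma Lcoef0 : Lcoef 0 = 1.
Proof.
rewrite /Lcoef (big_pred1 0) => [|v]; last by apply/esym/eqP/rowP => -[].
by rewrite /monic_of linear0 addr0 /Lchar residue1 psiP.1.
Qed.

Lemma Lpower1 : Lpower 1 = \sum_x psi f.[x].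
Proof.
rewrite /Lpower big_mkcond big_ord_recl big_ord1 /= add0r mulr1n.
rewrite (reindex (fun x : F => (- x)%:M : 'rV[F]_1)) /=; last first.
  exists (fun v => - v 0 0) => [x _|v _]; first by rewrite mxE eqxx opprK.
  by apply/rowP => i; rewrite !mxE (ord1 i) eqxx opprK.
have mE x : monic_of ((- x)%:M : 'rV[F]_1) = 'X - x%:P.
  rewrite /monic_of /rVpoly; apply/polyP => i; rewrite coefD coef_poly coefXn coefB coefX coefC.
  case: i => [|i]; rewrite /= ?add0r ?sub0r ?addr0 ?subr0 //.
  by case: insubP => //= j _ _; rewrite mxE (ord1 j) eqxx.
apply: eq_big => [x|x _]; last by rewrite mE /Lchar residue_XsubC.
by rewrite mE; apply/irreducibleP/irredp_XsubC.
Qed.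

(** Translating the coefficient of X^(m - d) by [c] permutes the monic polynomials of degree m and
    multiplies every [Lchar] by [psi a], by [residue_shift]; such a [c] exists because [d] is
    invertible in [F]. *)
Lemma Lcoef_eq0 p d a m : p \in [pchar F] -> psi a != 1 -> (0 < d)%N -> coprime p d ->
  size f = d.+1 -> (d <= m)%N -> Lcoef m = 0.
Proof.
move=> pF a1 d0 pd fd dm; have im : (m - d < m)%N by lia.
have dF : d%:R != 0 :> F.
  by rewrite -(dvdn_pcharf pF) -prime_coprime // (pcharf_prime pF).
have fF : lead_coef f != 0 by rewrite lead_coef_eq0 -size_poly_gt0 fd.
pose c := - a / (lead_coef f * d%:R).
apply/eqP; have : (1 - psi a) * Lcoef m == 0.
  rewrite mulrBl mul1r mulr_sumr /Lcoef.
  rewrite {1}(reindex_inj (addIr (c *: delta_mx 0 (Ordinal im)))) /= -sumrB big1 // => v _.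
  rewrite monic_of_add /Lchar (residue_shift _ d0 fd dm) ?monic_of_monic ?size_monic_of //.
  have -> : (c * lead_coef f) *+ d = - a.
    by rewrite -mulr_natr -mulrA /c divfK // mulf_neq0.
  by rewrite opprK psiP.2 mulrC subrr.
by rewrite mulf_eq0 subr_eq0 eq_sym (negPf a1).
Qed.

Lemma sum_multiples (R : nmodType) e m (G : nat -> R) : (0 < e)%N ->
  \sum_(j < m.+1 | (e * j.+1 <= m)%N) G (e * j.+1)%N =
  \sum_(k < m.+1 | (0 < k)%N && (e %| k)%N) G k.
Proof.
move=> e0; rewrite [RHS](reindex_onto (fun j : 'I_m.+1 => inord (e * j.+1))
  (fun k : 'I_m.+1 => inord (k %/ e).-1)) /=.
  rewrite [RHS]big_mkcond [LHS]big_mkcond; apply: eq_bigr => j _ /=.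
  have [em|em] := leqP (e * j.+1) m.
    by rewrite inordK // dvdn_mulr // mulKn // inord_val eqxx muln_gt0 e0.
  (* Out of range, [inord] returns 0, which the condition 0 < k excludes. *)
  have -> : inord (e * j.+1) = ord0 :> 'I_m.+1 by rewrite /inord /insubd insubF // ltnNge em.
  by rewrite ltnn.
move=> k /andP[k0 ek]; apply/val_inj; have km := ltn_ord k.
have kE : (e * (k %/ e).-1.+1 = k)%N.
  by rewrite prednK ?(mulnC e) ?divnK // divn_gt0 //; apply: dvdn_leq.
rewrite /= !inordK ?kE //; last by rewrite (leq_ltn_trans (leq_pred _)) // (leq_ltn_trans (leq_div _ _)).
by rewrite (leq_ltn_trans (leq_pred _)) // (leq_ltn_trans (leq_div _ _)).
Qed.

End LFunction.

(** The factor m is expanded as the sum of degree times multiplicity over irreducible P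
    ([sum_mult_count]). After exchanging sums, the multiples of P^(j + 1) contribute a power of
    [Lchar] times [Lcoef] in degree m - e (j + 1); terms are collected by k = e (j + 1). *)
Lemma Lcoef_recursion (F : finFieldType) (psi : F -> algC) (f : {poly F}) m :
  add_char psi ->
  Lcoef psi f m *+ m =
  \sum_(k < m.+1 | (0 < k)%N) Lpower psi f k * Lcoef psi f (m - k).
Proof.
move=> psiP; pose Lc := Lchar psi f.
have size_pow e (P : 'rV[F]_e) j : size (monic_of P ^+ j) = (e * j).+1.
  rewrite -[size _]prednK; first by rewrite size_exp size_monic_of.
  by rewrite size_poly_gt0 expf_neq0 // monic_neq0 // monic_of_monic.
pose G e k := (\sum_(P : 'rV[F]_e | irreducibleb (monic_of P))
  Lc (monic_of P) ^+ (k %/ e)) * Lcoef psi f (m - k) *+ e.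
transitivity (\sum_(e < m.+1) \sum_(j < m.+1 | (e * j.+1 <= m)%N) G e (e * j.+1)%N).
  transitivity (\sum_(e < m.+1) \sum_(P : 'rV[F]_e | irreducibleb (monic_of P))
      \sum_(j < m.+1) \sum_(v : 'rV[F]_m | monic_of P ^+ j.+1 %| monic_of v) Lc (monic_of v) *+ e).
    rewrite /Lcoef -sumrMnl.
    under eq_bigr => v _.
      rewrite -[m in _ *+ m]/(m.+1.-1) -(size_monic_of v).
      rewrite -(@sum_mult_count _ m) ?monic_of_monic ?size_monic_of // -sumrMnr.
      under eq_bigr do rewrite -sumrMnr.
      over.
    rewrite exchange_big; apply: eq_bigr => e _ /=.
    rewrite exchange_big; apply: eq_bigr => P _ /=.
    rewrite [RHS](exchange_big_dep xpredT) //=; apply: eq_bigr => v _.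
    rewrite mulnC mulrnA sumrMnl -sumrMnr; congr (_ *+ _).
    by rewrite [RHS]big_mkcond; apply: eq_bigr => j _; case: (_ %| _).
  apply: eq_bigr => e _; rewrite exchange_big [RHS]big_mkcond; apply: eq_bigr => j _ /=.
  under eq_bigr => P _.
    rewrite (@sum_monic_dvd _ _ _ _ _ (fun g => Lc g *+ e) _ (size_pow _ P _));
      last by rewrite monic_exp // monic_of_monic.
    over.
  case: ifP => [em|_]; last by rewrite big1.
  have [e0|e0] := posnP e.
    have mulne (x : algC) : x *+ e = 0 by rewrite e0 mulr0n.
    by rewrite /G mulne big1 // => P _; rewrite big1.
  rewrite /G mulr_suml -sumrMnl; apply: eq_bigr => P _.
  rewrite /Lcoef sumrMnl mulr_sumr; congr (_ *+ _); apply: eq_bigr => w _.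
  by rewrite mulKn // /Lc LcharM ?LcharXn ?monic_exp ?monic_of_monic.
transitivity (\sum_(e < m.+1) \sum_(k < m.+1 | (0 < k)%N && (e %| k)%N) G e k).
  apply: eq_bigr => e _; have [e0|e0] := posnP e; last exact: sum_multiples.
  by rewrite !big1 // => k _; rewrite /G e0 mulr0n.
rewrite (exchange_big_dep (fun k : 'I_m.+1 => (0 < k)%N)) /=; last by move=> e k _ /andP[].
apply: eq_bigr => k k0.
have -> : Lpower psi f k * Lcoef psi f (m - k) = \sum_(e < k.+1 | (e %| k)%N) G e k.
  by rewrite /Lpower mulr_suml; apply: eq_bigr => e _; rewrite /G mulrnAl.
rewrite (@big_ord_widen_cond _ _ _ k.+1 m.+1 (fun e => (e %| k)%N) (G^~ k)) //.
apply: eq_bigl => e.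
by rewrite k0 ltnS /=; case: (boolP (e %| k)%N) => // /(dvdn_leq k0) ->.
Qed.

(** * Character sums over extensions *)

Lemma card_finField_pchar (F : finFieldType) p : p \in [pchar F] ->
  exists n, #|F| = (p ^ n)%N.
Proof. by move=> pF; exists (logn p #|F|); have := card_pprimeChar pF. Qed.

Lemma expfD_card (F E : finFieldType) (iota : {rmorphism F -> E}) k (x y : E) :
  (x + y) ^+ (#|F| ^ k) = x ^+ (#|F| ^ k) + y ^+ (#|F| ^ k).
Proof.
have [p p_pr pF] := finPcharP F; have [n ->] := card_finField_pchar pF.
by rewrite -expnM pcharXnD // (rmorph_pchar iota).
Qed.

(** In the splitting field of X^m - X the roots are distinct, the derivative being -1, and they are
    the fixed points of the k-th power of Frobenius. So they form a subfield, which is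
    everything. *)
Lemma exists_extension (F : finFieldType) k : (0 < k)%N ->
  exists (E : finFieldType) (iota : {rmorphism F -> E}), #|E| = (#|F| ^ k)%N.
Proof.
move=> k0; set m := (_ ^ _)%N; pose g (K : nzRingType) : {poly K} := 'X^m - 'X.
have m1 : (1 < m)%N by rewrite (ltn_exp2l 0) ?finNzRing_gt1.
have gs (K : nzRingType) : size (g K) = m.+1.
  by rewrite size_polyDl size_polyXn // size_polyN size_polyX.
have g0 : g F != 0 by rewrite -size_poly_gt0 gs.
have [L] := FinSplittingFieldFor g0.
have -> : map_poly (in_alg L) (g F) = g L by rewrite rmorphB /= map_polyXn map_polyX.
case=> zs gzs zsL; pose E := FinFieldExtType L; exists E, (in_alg L).
have mL : m%:R = 0 :> L.
  have [p p_pr pF] := finPcharP F; have [n Fn] := card_finField_pchar pF.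
  have n0 : n != 0%N by apply: contraTneq (finNzRing_gt1 F) => n0; rewrite Fn n0.
  have pL : p \in [pchar L] by rewrite pchar_lalg.
  apply/eqP; rewrite -(dvdn_pcharf pL) /m Fn -expnM dvdn_exp //.
  by rewrite muln_gt0 lt0n n0.
have zs_uniq : uniq zs.
  rewrite -separable_prod_XsubC -(eqp_separable gzs) unlock derivB derivXn derivX.
  rewrite -mulr_natr -polyC_natr mL mulr0 sub0r.
  by rewrite -scaleN1r coprimepZr ?oppr_eq0 ?oner_eq0 // coprimep1.
have [/= a _ aP] := finField_galois_generator (sub1v {:L}%AS).
pose Em := fixedSpace (a ^+ k)%g.
have zsP : zs =i Em.
  move=> z; rewrite -root_prod_XsubC -(eqp_root gzs) (sameP fixedSpaceP eqP).
  rewrite /root !hornerE subr_eq0 /m; congr (_ == z).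
  elim: (k) => [|i IHi]; first by rewrite gal_id.
  by rewrite expgSr expnSr exprM IHi galM ?aP ?memvf // dimv1 expn1.
have EmL : Em = {:L}%VS.
  apply/eqP; rewrite eqEsubv subvf -zsL -[Em]subfield_closed agenvS //.
  by rewrite subv_add sub1v; apply/span_subvP=> z; rewrite zsP.
have -> : #|E| = size zs.
  have zsU : uniq (zs : seq E) := zs_uniq.
  by rewrite -(card_uniqP zsU); apply: eq_card => z; rewrite [RHS]zsP EmL memvf.
by apply: succn_inj; rewrite -(size_prod_XsubC _ id) -(eqp_size gzs) gs.
Qed.

(** * Frobenius orbits, minimal polynomials and the trace *)

Section Extension.

Variables (F E : finFieldType) (iota : {rmorphism F -> E}) (k : nat).
Hypotheses (card_E : #|E| = (#|F| ^ k)%N) (k_gt0 : (0 < k)%N).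

Let q := #|F|.

(* The unused iota makes the ring morphism structure of frob inferable: its       *)
(* additivity needs E to have the characteristic of F.                            *)
Definition frob (_ : {rmorphism F -> E}) (x : E) : E := x ^+ q.
Let phi := frob iota.

Fact frob_is_zmod_morphism : zmod_morphism phi.
Proof.
move=> x y; have D a b : phi (a + b) = phi a + phi b.
  by have := expfD_card iota 1 a b; rewrite expn1.
by apply/eqP; rewrite -subr_eq0 opprB addrA -D subrK subrr.
Qed.

Fact frob_is_monoid_morphism : monoid_morphism phi.
Proof. by split=> [|x y]; rewrite /phi /frob ?expr1n ?exprMn. Qed.

HB.instance Definition _ :=
  GRing.isZmodMorphism.Build E E phi frob_is_zmod_morphism.
HB.instance Definition _ :=
  GRing.isMonoidMorphism.Build E E phi frob_is_monoid_morphism.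

Lemma iter_frob i x : iter i phi x = x ^+ (q ^ i).
Proof.
by elim: i => [|i IHi]; rewrite ?expr1 // iterS IHi /phi /frob -exprM expnSr.
Qed.

Lemma frob_inj : injective phi.
Proof. exact: fmorph_inj. Qed.

Lemma iter_frob_id x : iter k phi x = x.
Proof. by rewrite iter_frob -card_E expf_card. Qed.

Lemma iotaP x : phi x = x -> exists a, iota a = x.
Proof.
move=> xx; have := congr1 (fun g => (map_poly iota g).[x]) (finField_genPoly F).
rewrite rmorphB /= map_polyXn map_polyX !hornerE [x ^+ _]xx subrr rmorph_prod horner_prod.
move/esym/eqP; rewrite prodf_seq_eq0 => /hasP[a _ /=]; rewrite map_polyXsubC !hornerE subr_eq0.
by move=> /eqP ->; exists a.
Qed.

Definition iota_inv (x : E) : F := odflt 0 [pick a | iota a == x].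

Lemma iota_invK x : phi x = x -> iota (iota_inv x) = x.
Proof.
case/iotaP=> a ax; rewrite /iota_inv; case: pickP => [b /eqP //|/(_ a)].
by rewrite ax eqxx.
Qed.

Lemma descend_poly (P : {poly E}) : map_poly phi P = P -> exists Q, map_poly iota Q = P.
Proof.
move=> PP; exists (\poly_(i < size P) iota_inv P`_i); apply/polyP => i.
rewrite coef_map coef_poly; case: ltnP => iP; last by rewrite nth_default ?(raddf0 iota) //; exact: rmorph0.
by apply: iota_invK; rewrite -[in RHS]PP coef_map.
Qed.

Definition orbit_poly x : {poly E} := \prod_(y <- orbit phi x) ('X - y%:P).

Lemma root_orbit_poly x y : root (orbit_poly x) y = (y \in orbit phi x).
Proof. exact: root_prod_XsubC. Qed.

Lemma orbit_polyP x : exists Q, [/\ map_poly iota Q = orbit_poly x, Q \is monic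
  & size Q = (order phi x).+1].
Proof.
have [|Q QE] := @descend_poly (orbit_poly x).
  rewrite rmorph_prod /=; under eq_bigr do rewrite map_polyXsubC.
  rewrite /orbit_poly -(big_map phi xpredT (fun y => 'X - y%:P)); apply: perm_big.
  have sub : {subset map phi (orbit phi x) <= orbit phi x}.
    move=> z /mapP[y yx ->]; rewrite -!fconnect_orbit in yx *.
    exact: connect_trans yx (fconnect1 _ _).
  have [||_ e] := uniq_min_size _ sub.
  - by rewrite map_inj_uniq ?orbit_uniq //; apply: frob_inj.
  - by rewrite size_map.
  by apply: uniq_perm => //; rewrite ?map_inj_uniq ?orbit_uniq //; apply: frob_inj.
exists Q; split=> //.
  by rewrite -(map_monic iota) QE monic_prod_XsubC.
by rewrite -(size_map_poly iota) QE size_prod_XsubC size_orbit.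
Qed.

Lemma root_frob (P : {poly F}) x y : root (map_poly iota P) x -> y \in orbit phi x ->
  root (map_poly iota P) y.
Proof.
move=> Px; rewrite -fconnect_orbit => /iter_findex <-.
elim: (findex _ _ _) => // i IHi; rewrite iterS; move: (iter i phi x) IHi => z zP.
have -> : map_poly iota P = map_poly phi (map_poly iota P).
  rewrite -map_poly_comp; apply: eq_map_poly => a /=.
  by rewrite /phi /frob -rmorphXn /= expf_card.
by rewrite /root horner_map fmorph_eq0.
Qed.

Lemma irreducible_root_orbit (P : {poly F}) x : P \is monic -> irreducible_poly P ->
  root (map_poly iota P) x -> map_poly iota P = orbit_poly x.
Proof.
move=> Pm [P1 Pi] Px; have [Q [QE Qm Qs]] := orbit_polyP x.
rewrite -QE; congr (map_poly _ _); apply/eqP; rewrite eq_sym -eqp_monic //.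
apply: Pi; first by rewrite Qs eqSS -lt0n order_gt0.
rewrite -(dvdp_map iota) QE; apply: uniq_roots_dvdp.
  by apply/allP => y /(root_frob Px).
by rewrite uniq_rootsE orbit_uniq.
Qed.

Lemma exists_irreducible_root x : exists P : {poly F},
  [/\ P \is monic, irreducible_poly P & root (map_poly iota P) x].
Proof.
have [Q [QE Qm Qs]] := orbit_polyP x.
have [|P [Pm Pi PQ]] := @exists_monic_irreducible_factor _ Q; first by rewrite Qs ltnS order_gt0.
exists P; split=> //; have Pd : map_poly iota P %| orbit_poly x by rewrite -QE dvdp_map.
have [[|y s] Ps _] : exists2 s, map_poly iota P %= \prod_(y <- s) ('X - y%:P)
    & {subset s <= orbit phi x}.
- have [m mP] := dvdp_prod_XsubC Pd; exists (mask m (orbit phi x)) => // y.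
  exact: mem_mask.
- have [P1 _] := Pi; move: (eqp_size Ps).
  by rewrite size_map_poly big_nil size_poly1 => P1'; rewrite P1' in P1.
have yP : root (map_poly iota P) y by rewrite (eqp_root Ps) root_prod_XsubC mem_head.
apply: (root_frob yP).
have : y \in orbit phi x.
  by rewrite -root_orbit_poly -dvdp_XsubCl; apply: dvdp_trans Pd; rewrite dvdp_XsubCl.
by rewrite -!fconnect_orbit (fconnect_sym frob_inj).
Qed.

Lemma iter_order_mod i x : iter i phi x = iter (i %% order phi x) phi x.
Proof.
rewrite {1}(divn_eq i (order phi x)) addnC iterD; congr (iter _ _ _).
elim: (i %/ _)%N => // n IHn; rewrite mulSn iterD IHn.
exact: iter_order frob_inj x.
Qed.

Lemma order_dvd i x : iter i phi x = x -> (order phi x %| i)%N.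
Proof.
rewrite iter_order_mod => ix; have im : (i %% order phi x < order phi x)%N.
  by rewrite ltn_mod order_gt0.
by have := findex_iter im; rewrite ix findex0 => /esym/eqP.
Qed.

(** In F[X]/P, a field with q^e elements, X^(q^k) = X because e divides k; so P divides X^(q^k) - X,
    which splits over [E]. *)
Lemma exists_root (P : {poly F}) e : P \is monic -> irreducible_poly P ->
  size P = e.+1 -> (e %| k)%N -> exists x, root (map_poly iota P) x.
Proof.
move=> Pm Pi Ps ek; have hI : monic_irreducible_poly P by split.
have Kcard : #|{poly %/ P with hI}| = (q ^ e)%N by rewrite card_qfpoly Ps.
have XK (x : {poly %/ P with hI}) : x ^+ (q ^ k) = x.
  have /dvdnP[c ->] := ek; elim: c => [|c IHc]; first by rewrite expr1.
  by rewrite mulSn expnD exprM -Kcard expf_card.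
have PX : P %| 'X^(q ^ k) - 'X.
  have : in_qpoly P ('X^(q ^ k) - 'X) = 0 by rewrite rmorphB rmorphXn /= [X in X - _]XK subrr.
  move/(congr1 (fun r : {poly %/ P} => r : {poly F})) => /= /eqP.
  by rewrite (mk_monicE hI) -[_ == _]/(Pdiv.CommonRing.rdvdp _ _) -Pdiv.Idomain.dvdpE.
have : map_poly iota P %| \prod_(x : E) ('X - x%:P).
  by rewrite -finField_genPoly card_E -/q -(map_polyX iota) -rmorphXn -rmorphB /= dvdp_map.
case/dvdp_prod_XsubC=> m mP.
case: (mask _ _) mP => [/eqp_size|y s /eqp_root yP].
  have [P1 _] := Pi.
  by rewrite size_map_poly big_nil size_poly1 => P1'; rewrite P1' in P1.
by exists y; rewrite yP root_prod_XsubC mem_head.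
Qed.

Lemma sum_iter_orbit (g : E -> E) x :
  \sum_(i < k) g (iter i phi x) = (\sum_(y <- orbit phi x) g y) *+ (k %/ order phi x).
Proof.
set e := order phi x.
have -> : \sum_(y <- orbit phi x) g y = \sum_(i < e) g (iter i phi x).
  rewrite /orbit (big_nth x) size_traject big_mkord; apply: eq_bigr => i _.
  by rewrite nth_traject.
have sumM c : \sum_(i < c * e) g (iter i phi x) = (\sum_(i < e) g (iter i phi x)) *+ c.
  elim: c => [|c IHc]; first by rewrite mul0n big_ord0.
  rewrite mulSn big_split_ord /= mulrS -IHc; congr (_ + _); apply: eq_bigr => i _.
  by rewrite addnC iterD iter_order //; apply: frob_inj.
by rewrite -sumM divnK // order_dvd // iter_frob_id.
Qed.

Definition ext_trace (z : E) : F := iota_inv (\sum_(i < k) z ^+ (q ^ i)).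

Lemma ext_traceK z : iota (ext_trace z) = \sum_(i < k) z ^+ (q ^ i).
Proof.
apply: iota_invK; rewrite rmorph_sum /=.
case: k card_E k_gt0 => // k' cE _.
rewrite [LHS]big_ord_recr [RHS]big_ord_recl /= addrC; congr (_ + _).
  by rewrite /phi /frob -exprM -expnSr -cE expf_card.
by apply: eq_bigr => i _; rewrite /phi /frob -exprM -expnSr.
Qed.

Lemma ext_traceD : {morph ext_trace : x y / x + y}.
Proof.
move=> x y; apply: (fmorph_inj iota); rewrite rmorphD /= !ext_traceK -big_split.
by apply: eq_bigr => i _; rewrite /= (expfD_card iota).
Qed.

Lemma ext_trace0 : ext_trace 0 = 0.
Proof. by apply: (addrI (ext_trace 0)); rewrite -ext_traceD !addr0. Qed.

Lemma ext_trace_iotaM a z : ext_trace (iota a * z) = a * ext_trace z.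
Proof.
apply: (fmorph_inj iota); rewrite rmorphM /= !ext_traceK mulr_sumr; apply: eq_bigr => i _.
rewrite exprMn -rmorphXn /=; congr (iota _ * _).
by elim: (nat_of_ord i) => [|j IHj]; rewrite ?expr1 // expnSr exprM IHj expf_card.
Qed.

Lemma ext_trace_frob z n p : p \in [pchar F] ->
  ext_trace (z ^+ (p ^ n)) = ext_trace z ^+ (p ^ n).
Proof.
move=> pF; apply: (fmorph_inj iota); rewrite rmorphXn /= !ext_traceK pcharXn_sum ?(rmorph_pchar iota) //.
by apply: eq_bigr => i _; rewrite -!exprM mulnC.
Qed.

(** The trace is a polynomial of degree q^(k - 1), too small to vanish on all of [E]. *)
Lemma exists_trace_neq0 : exists z, ext_trace z != 0.
Proof.
pose g : {poly E} := \sum_(i < k) 'X^(q ^ i).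
have q1 : (1 < q)%N by apply: finNzRing_gt1.
have gs : (size g <= (q ^ k.-1).+1)%N.
  apply: (leq_trans (size_sum _ _ _)); apply/bigmax_leqP => i _.
  by rewrite size_polyXn ltnS leq_exp2l // -ltnS prednK.
have g0 : g != 0.
  have k1 : (k.-1 < k)%N by rewrite prednK.
  suff : g`_(q ^ k.-1) != 0 by apply: contraNneq => ->; rewrite coef0.
  rewrite coef_sum (bigD1 (Ordinal k1)) //= coefXn eqxx big1 ?addr0 ?oner_eq0 // => i ik.
  rewrite coefXn eqn_exp2l //; case: eqP => // ki; case/eqP: ik.
  exact/val_inj/esym.
have [z|noz] := pickP (fun z => ext_trace z != 0); first by exists z.
have := max_poly_roots g0 _ (enum_uniq E); rewrite -cardE card_E => /(_ _).
have -> : all (root g) (enum E).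
  apply/allP => z _; have := noz z; rewrite /root /g horner_sum => /negbFE/eqP z0.
  under eq_bigr do rewrite hornerXn.
  by rewrite -ext_traceK z0 rmorph0.
move=> /(_ isT)/leq_trans/(_ gs); rewrite ltnS leq_exp2l // leqNgt.
by rewrite prednK ?leqnn.
Qed.

(** The k Frobenius iterates of x run k / e times through the e roots of P, over which [residue]
    sums f. *)
Lemma ext_trace_root (f P : {poly F}) x : P \is monic -> irreducible_poly P ->
    root (map_poly iota P) x ->
  ext_trace (map_poly iota f).[x] = residue f P *+ (k %/ (size P).-1).
Proof.
move=> Pm Pi Px; have PE := irreducible_root_orbit Pm Pi Px.
have -> : (size P).-1 = order phi x.
  by rewrite -(size_map_poly iota) PE size_prod_XsubC size_orbit.
apply: (fmorph_inj iota); rewrite ext_traceK rmorphMn /= -residue_map PE.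
rewrite residue_prod => [|y]; last exact: monicXsubC.
under eq_bigr => i _ do rewrite -iter_frob.
transitivity (\sum_(i < k) (map_poly iota f).[iter i phi x]).
  apply: eq_bigr => i _; elim: (nat_of_ord i) => //= j ->; rewrite -horner_map /=.
  congr (_.[_]); rewrite -map_poly_comp; apply: eq_map_poly => a /=.
  by rewrite /phi /frob -rmorphXn /= expf_card.
rewrite (sum_iter_orbit (fun y => (map_poly iota f).[y])); congr (_ *+ _).
by apply: eq_bigr => y _; rewrite residue_XsubC.
Qed.

(** Elements of [E] are grouped by minimal polynomial: an irreducible P of degree e dividing k has
    exactly e roots in [E], all with the same trace of f. *)
Lemma LpowerE (psi : F -> algC) (f : {poly F}) : add_char psi ->
  Lpower psi f k = \sum_(x : E) psi (ext_trace (map_poly iota f).[x]).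
Proof.
move=> psiP; pose h x := psi (ext_trace (map_poly iota f).[x]).
transitivity (\sum_(e < k.+1 | (e %| k)%N) \sum_(v : 'rV[F]_e | irreducibleb (monic_of v))
    \sum_(x : E | root (map_poly iota (monic_of v)) x) h x).
  apply: eq_bigr => e ek; rewrite -sumrMnl; apply: eq_bigr => v /irreducibleP vi.
  have vm := monic_of_monic v; have [x0 x0P] := exists_root vm vi (size_monic_of v) ek.
  have vE := irreducible_root_orbit vm vi x0P.
  have e_order : #|root (map_poly iota (monic_of v))| = e.
    rewrite -[RHS]/(e.+1.-1) -(size_monic_of v) -(size_map_poly iota) vE size_prod_XsubC.
    rewrite -(card_uniqP (orbit_uniq phi x0)); apply: eq_card => y.
    by rewrite -root_orbit_poly.
  rewrite -[X in _ *+ X]e_order -sumr_const; apply: eq_bigr => x xv.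
  by rewrite /h (ext_trace_root f vm vi xv) add_charMn // size_monic_of.
under eq_bigr => e _ do rewrite (exchange_big_dep xpredT) //=.
rewrite (exchange_big_dep xpredT) //=; apply: eq_bigr => x _.
have [P [Pm Pi Px]] := exists_irreducible_root x.
have Ps : size P = (order phi x).+1.
  by rewrite -(size_map_poly iota) (irreducible_root_orbit Pm Pi Px) size_prod_XsubC size_orbit.
have ek : (order phi x %| k)%N by rewrite order_dvd // iter_frob_id.
have el : (order phi x < k.+1)%N by rewrite ltnS dvdn_leq.
have uniqP e (v : 'rV[F]_e) : irreducibleb (monic_of v) ->
    root (map_poly iota (monic_of v)) x -> monic_of v = P.
  move=> /irreducibleP vi vx; apply: (map_poly_inj iota).
  by rewrite !(irreducible_root_orbit _ _ vx) ?(irreducible_root_orbit _ _ Px) // monic_of_monic.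
rewrite (bigD1 (Ordinal el)) ?andbT //= [X in Algebra.add _ X]big1 ?addr0.
  rewrite (big_pred1 (poly_rV P)) // => v /=; apply/andP/eqP => [[vi vx]|->].
    by rewrite -(uniqP _ _ vi vx) monic_ofK.
  by rewrite poly_rVK_monic //; split=> //; apply/irreducibleP.
move=> e /andP[_ ne]; rewrite big1 // => v /andP[vi vx]; case/eqP: ne; apply/val_inj.
by apply: succn_inj; rewrite /= -Ps -(uniqP _ _ vi vx) size_monic_of.
Qed.

End Extension.

(** * The Weil bound *)

(** In degree 2 n the square root of #|E| is s = #|F|^n. Twisting by [gamma] makes the trace
    character trivial on y^p - y, as the trace commutes with p-th powers; dividing f by [gamma]
    undoes the twist. *)
Lemma Lpower_double_bound (F : finFieldType) p d (psi : F -> algC) a (f : {poly F}) :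
    p \in [pchar F] -> add_char psi -> psi a != 1 -> (0 < d)%N -> coprime p d ->
    size f = d.+1 ->
  exists n0, forall n, (n0 <= n)%N -> `|Lpower psi f (n + n)| <= (2 * p * d * #|F| ^ n)%:R.
Proof.
move=> pF psiP psi_a d0 pd fd; pose N := (d * d * p + 2 * d)%N.
have [gamma g0 gP] := exists_twist psiP pF psi_a.
have [r Fr] := card_finField_pchar pF.
have r0 : (0 < r)%N.
  by rewrite lt0n; apply: contraTneq (finNzRing_gt1 F) => r0; rewrite Fr r0.
have p1 : (1 < p)%N by apply/prime_gt1/(pcharf_prime pF).
(* Then p^(r n - 1) >= r n - 1 >= N, as [stepanov_sum] requires. *)
exists N.+1 => n Nn; have n0 : (0 < n + n)%N by lia.
have [E [iota cE]] := exists_extension F n0.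
pose s := (#|F| ^ n)%N.
have sE : s = (p ^ (r * n))%N by rewrite /s Fr expnM.
have rn : (N < r * n)%N by nia.
have sgE : s = (p * p ^ (r * n).-1)%N by rewrite sE -expnS prednK // (leq_ltn_trans _ rn).
have sg_large : (N <= p ^ (r * n).-1)%N.
  by rewrite (@leq_trans (r * n).-1) // ?(ltnW (ltn_expl _ p1)) //; lia.
have cE' : #|E| = (s * s)%N by rewrite cE expnD.
have pE : p \in [pchar E] by rewrite (rmorph_pchar iota).
pose tr := ext_trace iota (n + n).
have trB x y : tr (x - y) = tr x - tr y.
  by apply/eqP; rewrite eq_sym subr_eq -(ext_traceD iota cE n0) subrK.
pose Psi (z : E) := psi (gamma * tr z).
have PsiP : add_char Psi.
  split=> [|x y]; first by rewrite /Psi /tr (ext_trace0 iota cE n0) mulr0 psiP.1.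
  by rewrite /Psi /tr (ext_traceD iota cE n0) mulrDr psiP.2.
have [z0 z0P] := exists_trace_neq0 iota cE n0.
have Psi_b : Psi (iota (a / (gamma * tr z0)) * z0) != 1.
  rewrite /Psi /tr (ext_trace_iotaM iota cE n0) -/tr.
  by rewrite [X in psi X](_ : _ = a) // mulrCA divfK // mulf_neq0.
have Psi_pX y : Psi (y ^+ p - y) = 1.
  rewrite /Psi trB; have := ext_trace_frob iota cE n0 y 1 pF.
  by rewrite expn1 -/tr => ->; apply: gP.
pose f1 := map_poly iota (gamma^-1 *: f).
have f1d : size f1 = d.+1 by rewrite size_map_poly size_scale ?invr_eq0.
have := stepanov_sum pE d0 pd f1d sE sgE cE' sg_large PsiP Psi_b Psi_pX.
rewrite (LpowerE iota cE n0 _ psiP); congr (`|_| <= _); apply: eq_bigr => x _.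
rewrite /Psi /f1 map_polyZ hornerZ /tr (ext_trace_iotaM iota cE n0).
by rewrite mulrA divff // mul1r.
Qed.

Lemma bernoulli (R : numDomainType) (t : R) n : 0 <= t -> 1 + t *+ n <= (1 + t) ^+ n.
Proof.
move=> t0; elim: n => [|n IHn]; first by rewrite mulr0n addr0.
have t1 : 0 <= 1 + t by rewrite addr_ge0.
rewrite exprS; apply: le_trans (ler_wpM2l t1 IHn).
have -> : (1 + t) * (1 + t *+ n) = 1 + t *+ n.+1 + t * (t *+ n) by rewrite mulrS; ring.
by rewrite lerDl mulr_ge0 // mulrn_wge0.
Qed.

(* An interpolation polynomial vanishing on the other elements of s isolates z   *)
(* in the power sums.                                                            *)
Lemma norm_le1_power_sums (s : seq algC) C n0 z :
  (forall n, (n0 <= n)%N -> `|\sum_(y <- s) y ^+ n| <= C) -> z \in s -> `|z| <= 1.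
Proof.
move=> sC zs; case: (real_leP (normr_real z) (rpred1 _)) => // z1.
pose h := \prod_(y <- undup s | y != z) ('X - y%:P).
have hz : h.[z] != 0.
  rewrite horner_prod prodf_seq_neq0; apply/allP => y _; apply/implyP => yz.
  by rewrite !hornerE subr_eq0 eq_sym.
have hy y : y \in s -> y != z -> h.[y] = 0.
  move=> ys yz; rewrite horner_prod; apply/eqP; rewrite prodf_seq_eq0.
  by apply/hasP; exists y; rewrite ?mem_undup // yz !hornerE subrr eqxx.
pose K := `|h.[z] *+ count_mem z s|.
have K0 : 0 < K by rewrite normr_gt0 mulrn_eq0 negb_or hz -lt0n -has_count has_pred1 zs.
pose D := \sum_(k < size h) `|h`_k| * C.
have bound n : (n0 <= n)%N -> `|z| ^+ n * K <= D.
  move=> n0n; have -> : `|z| ^+ n * K = `|\sum_(k < size h) h`_k * \sum_(y <- s) y ^+ (n + k)|.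
    rewrite /K -normrX -normrM; congr `|_|.
    under eq_bigr do rewrite mulr_sumr.
    rewrite exchange_big /=.
    transitivity (\sum_(y <- s) (y ^+ n * h.[y])).
      rewrite (bigID (pred1 z)) /= [X in _ + X]big_seq_cond [X in _ + X]big1 ?addr0.
        rewrite (eq_bigr (fun=> z ^+ n * h.[z])) => [|y /eqP-> //].
        by rewrite big_const_seq iter_addr_0 mulrnAr.
      by move=> y /andP[ys yz]; rewrite hy ?mulr0.
    apply: eq_bigr => y _; rewrite horner_coef mulr_sumr; apply: eq_bigr => k _.
    by rewrite exprD mulrCA.
  apply: (le_trans (ler_norm_sum _ _ _)); apply: ler_sum => k _.
  by rewrite normrM ler_wpM2l // sC // (leq_trans n0n) ?leq_addr.
pose t := `|z| - 1; have t0 : 0 < t by rewrite subr_gt0.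
have D0 : 0 <= D by apply: le_trans (bound n0 (leqnn _)); rewrite mulr_ge0 ?exprn_ge0 // ltW.
pose m := Num.bound (D / K / t).
suff lt_bound : D < `|z| ^+ (n0 + m) * K.
  by have := bound (n0 + m)%N (leq_addr _ _); rewrite (lt_geF lt_bound).
rewrite -ltr_pdivrMr //.
have zt : `|z| = 1 + t by rewrite /t addrC subrK.
apply: lt_le_trans (_ : 1 + t *+ (n0 + m) <= _); last by rewrite zt bernoulli // ltW.
have mD : D / K < t *+ m.
  by rewrite -mulr_natl -ltr_pdivrMr // archi_boundP // !divr_ge0 // ltW.
by rewrite mulrnDr addrA (lt_le_trans mD) // lerDr addr_ge0 // mulrn_wge0 // ltW.
Qed.

Section Newton.

Variable (R : comNzRingType).

Let L (s : seq R) : {poly R} := \prod_(z <- s) (1 - z *: 'X).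
Let T M (s : seq R) : {poly R} := \sum_(z <- s) \sum_(k < M) z ^+ k.+1 *: 'X^(k.+1).

(** The logarithmic derivative of the product of the 1 - z X, with geometric series truncated at
    degree [M]. *)
Lemma newton_poly M s : exists Q, 'X * (L s)^`() = - (L s * T M s) + 'X^(M.+1) * Q.
Proof.
elim: s => [|z s [Q IHs]].
  by exists 0; rewrite /L /T !big_nil derivC !mulr0 addr0 oppr0.
pose u := \sum_(k < M) z ^+ k.+1 *: 'X^(k.+1) : {poly R}.
have uE : (1 - z *: 'X) * u = z *: 'X - z ^+ M.+1 *: 'X^(M.+1).
  rewrite mulrBl mul1r mulr_sumr -sumrB.
  under eq_bigr => k _ do rewrite -scalerAl -scalerAr scalerA -exprS -exprS -opprB.
  rewrite sumrN -(big_mkord xpredT (fun k => z ^+ k.+2 *: 'X^(k.+2) - z ^+ k.+1 *: 'X^(k.+1))).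
  by rewrite (telescope_sumr (fun k => z ^+ k.+1 *: 'X^(k.+1))) // opprB !expr1.
exists ((1 - z *: 'X) * Q - z ^+ M.+1 *: L s).
rewrite /L /T !big_cons -/(L s) -/(T M s) -/u derivM derivB derivC derivZ derivX sub0r.
have alg (A B X L0 L1 T0 U W : {poly R}) : (1 - A) * U = A - W ->
    X * L1 = - (L0 * T0) + B ->
  - A * L0 + (1 - A) * (X * L1)
    = - ((1 - A) * L0 * (U + T0)) + ((1 - A) * B - W * L0).
  move=> hU ->; have -> : W = A - (1 - A) * U by rewrite hU opprB addrC subrK.
  ring.
transitivity (- (z *: 'X) * L s + (1 - z *: 'X) * ('X * (L s)^`())).
  by rewrite alg_polyC -!mul_polyC; ring.
rewrite (alg _ _ _ _ _ _ _ _ uE IHs) -!mul_polyC; ring.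
Qed.

Lemma newton_coef s m : (L s)`_m *+ m =
  - \sum_(k < m.+1 | (0 < k)%N) (\sum_(z <- s) z ^+ k) * (L s)`_(m - k).
Proof.
have [Q /(congr1 (fun P : {poly R} => P`_m))] := newton_poly m s.
have -> : ('X * (L s)^`())`_m = (L s)`_m *+ m.
  by rewrite coefXM; case: m => [|m] /=; rewrite ?mulr0n // coef_deriv.
move=> ->; rewrite coefD coefXnM ltnSn addr0 coefN coefMr; congr (- _).
rewrite [RHS]big_mkcond; apply: eq_bigr => k _; rewrite mulrC.
have -> : (T m s)`_k = if (0 < k)%N then \sum_(z <- s) z ^+ k else 0.
  rewrite coef_sum; under eq_bigr do rewrite coef_sum.
  have := ltn_ord k; case: (nat_of_ord k) => [|j] jm /=.
    by rewrite big1 // => z _; rewrite big1 // => i _; rewrite coefZ coefXn mulr0.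
  apply: eq_bigr => z _; rewrite (bigD1 (Ordinal (jm : (j < m)%N))) //= coefZ coefXn eqxx mulr1.
  rewrite big1 ?addr0 // => i ij; rewrite coefZ coefXn eqSS eq_sym.
  by case: eqP => [e|]; [case/eqP: ij; apply: val_inj|rewrite mulr0].
by case: ifP => _; rewrite ?mul0r.
Qed.

End Newton.

(** The L-function [Lp] has constant term 1 and degree below d, so it is a product of at most d - 1
    factors 1 - z X. Newton's identities have the shape of [Lcoef_recursion], whence [Lpower] is
    minus the power sum of the z. Its even values force |z|^2 <= #|F|, and its value at 1 is the sum
    to bound. *)
Theorem weil_bound (F : finFieldType) p d (psi : F -> algC) a (f : {poly F}) :
    p \in [pchar F] -> add_char psi -> psi a != 1 -> (0 < d)%N -> coprime p d ->
    size f = d.+1 ->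
  `|\sum_x psi f.[x]| <= (d.-1)%:R * sqrtC (#|F|%:R).
Proof.
move=> pF psiP psi_a d0 pd fd.
pose Lp := \poly_(m < d) Lcoef psi f m.
have LpE m : Lp`_m = Lcoef psi f m.
  rewrite coef_poly; case: ltnP => // dm.
  by rewrite (Lcoef_eq0 psiP pF psi_a d0 pd fd dm).
have Lp0 : Lp`_0 = 1 by rewrite LpE Lcoef0.
have Lp_neq0 : Lp != 0 by apply: contraTneq (oner_neq0 algC) => E; rewrite -Lp0 E coef0 eqxx.
have [rs LpF] := closed_field_poly_normal Lp.
pose s := [seq z^-1 | z <- rs].
have rs0 z : z \in rs -> z != 0.
  move=> zr; apply/eqP => z0.
  have : root Lp z by rewrite LpF rootZ ?lead_coef_eq0 // root_prod_XsubC.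
  by rewrite z0 rootE horner_coef0 Lp0 oner_eq0.
have Ls : Lp = \prod_(z <- s) (1 - z *: 'X).
  have [c E] : exists c, Lp = c *: \prod_(z <- s) (1 - z *: 'X).
    exists (lead_coef Lp * \prod_(z <- rs) - z); rewrite [LHS]LpF -scalerA; congr (_ *: _); rewrite big_map.
    rewrite -mul_polyC rmorph_prod -big_split /=; apply: eq_big_seq => z /rs0 z0.
    rewrite mulrBr mulr1 mul_polyC scalerA mulNr divff // scaleN1r opprK polyCN addrC.
    by [].
  rewrite E; have := congr1 (fun P : {poly algC} => P.[0]) E.
  rewrite horner_coef0 Lp0 hornerZ horner_prod big1 => [|z _].
    by rewrite mulr1 => <-; rewrite scale1r.
  by rewrite !hornerE subr0.
have size_s : (size s <= d.-1)%N.
  have := congr1 (size \o polyseq) LpF.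
  rewrite /= size_scale ?lead_coef_eq0 // size_prod_XsubC size_map => E.
  by rewrite -ltnS -E prednK // size_poly.
have powE k : (0 < k)%N -> Lpower psi f k = - \sum_(z <- s) z ^+ k.
  have [n] := ubnP k; elim: n k => // n IHn k kn k0.
  have := newton_coef s k; rewrite -Ls LpE Lcoef_recursion //.
  rewrite -sumrN (bigD1 ord_max) //= [RHS](bigD1 ord_max) //= subnn LpE (Lcoef0 f psiP) !mulr1.
  rewrite (eq_bigr (fun j : 'I_k.+1 => - ((\sum_(z <- s) z ^+ j) * Lp`_(k - j)))).
    by move/addIr.
  move=> j /andP[j0 jk]; rewrite IHn ?mulNr ?LpE //.
  have : (j : nat) != k by [].
  by have := ltn_ord j; lia.
have [n0 n0P] := Lpower_double_bound pF psiP psi_a d0 pd fd.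
pose Q : algC := #|F|%:R.
have Q0 : 0 < Q by rewrite ltr0n; apply/card_gt0P; exists 0.
have norm_s z : z \in s -> `|z| <= sqrtC Q.
  move=> zs; suff : `|z ^+ 2 / Q| <= 1.
    rewrite normrM normfV (gtr0_norm Q0) normrX ler_pdivrMr // mul1r => zQ.
    by rewrite -(@ler_pXn2r _ 2) ?nnegrE ?sqrtC_ge0 ?(ltW Q0) // sqrtCK.
  apply: (@norm_le1_power_sums [seq y ^+ 2 / Q | y <- s] (2 * p * d)%:R n0.+1).
    move=> n n0n; rewrite big_map.
    have -> : \sum_(y <- s) (y ^+ 2 / Q) ^+ n = - Lpower psi f (n + n) / Q ^+ n.
      rewrite powE ?opprK ?mulr_suml; last by lia.
      by apply: eq_bigr => y _; rewrite exprMn exprVn -exprM mul2n addnn.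
    rewrite normrM normrN normfV normrX (gtr0_norm Q0) ler_pdivrMr ?exprn_gt0 //.
    by rewrite -natrX -natrM; apply: n0P; lia.
  by apply/mapP; exists z.
rewrite -(Lpower1 psi f) powE // normrN.
under eq_bigr do rewrite expr1.
apply: (le_trans (ler_norm_sum _ _ _)).
apply: (@le_trans _ _ (\sum_(z <- s) sqrtC Q)).
  by rewrite big_seq [leRHS]big_seq; apply: ler_sum => z /norm_s.
rewrite big_const_seq count_predT iter_addr_0 -[leLHS]mulr_natl ler_wpM2r ?sqrtC_ge0 ?(ltW Q0) //.
by rewrite ler_nat.
Qed.

(** * Equidistribution *)

Lemma exists_Fp_char p : prime p ->
  exists2 chi : 'F_p -> algC, add_char chi & chi 1 != 1.
Proof.
move=> p_pr; have [z zP] := C_prim_root_exists (prime_gt0 p_pr).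
have modE a : (a %% (Zp_trunc (pdiv p)).+2 = a %% p)%N by rewrite Fp_cast.
exists (fun x => z ^+ x).
  split=> [|x y]; first by rewrite expr0.
  by rewrite -exprD -(prim_expr_mod zP (x + y)) /= modE.
have -> : nat_of_ord (1 : 'F_p) = 1%N by rewrite /= modE modn_small // prime_gt1.
by rewrite -(prim_order_dvd zP) dvdn1; apply: contraTneq (prime_gt1 p_pr) => ->.
Qed.

Lemma sum_Fp_char p (chi : 'F_p -> algC) t : prime p -> add_char chi -> chi 1 != 1 ->
  \sum_u chi (u * t) = (t == 0)%:R * p%:R.
Proof.
move=> p_pr chiP chi1; have [->|t0] := eqVneq t 0.
  under eq_bigr do rewrite mulr0 chiP.1.
  by rewrite sumr_const mul1r card_Fp.
rewrite mul0r -[RHS](sum_add_char chiP chi1).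
by rewrite [RHS](reindex_inj (mulIf t0)).
Qed.

Lemma coef_comp_XaddC (R : comNzRingType) (f : {poly R}) a k :
  (f \Po ('X + a%:P))`_k = \sum_(m < size f) f`_m * (a ^+ (m - k) *+ 'C(m, k)).
Proof.
rewrite coef_comp_poly; apply: eq_bigr => m _; congr (_ * _).
rewrite exprDn coef_sum.
have coefi i : ('X^(m - i) * a%:P ^+ i *+ 'C(m, i) : {poly R})`_k
    = (k == (m - i)%N)%:R * a ^+ i *+ 'C(m, i).
  by rewrite coefMn -rmorphXn /= coefMC coefXn.
have [km|mk] := leqP k m; last first.
  by rewrite bin_small // big1 // => i _; rewrite coefi gtn_eqF ?mul0r ?mul0rn //; lia.
have mkm : (m - k < m.+1)%N by lia.
rewrite (bigD1 (Ordinal mkm)) //= coefi /= subKn // eqxx mul1r bin_sub // big1 ?addr0 // => i ik.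
rewrite coefi; case: eqP => [kE|_]; last by rewrite mul0r mul0rn.
by case/eqP: ik; apply: val_inj => /=; rewrite kE subKn // -ltnS ltn_ord.
Qed.

(** No factor of d (d - 1) ... (d - j + 1) is divisible by [p]. *)
Lemma bin_pchar_neq0 p d j : prime p -> (j <= d %% p)%N -> ~~ (p %| 'C(d, j))%N.
Proof.
move=> p_pr jd; have : ~~ (p %| d ^_ j)%N.
  elim: j jd => [|j IHj] jd; first by rewrite ffactn0 dvdn1 gtn_eqF ?prime_gt1.
  rewrite ffactnSr Euclid_dvdM // negb_or IHj ?(ltnW jd) //=.
  have jd' : (j <= d)%N by rewrite (leq_trans (ltnW jd)) ?leq_mod.
  rewrite -eqn_mod_dvd //; apply/eqP => e.
  by move: jd; rewrite e ltnNge leq_mod.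
by rewrite -bin_ffact; apply: contra => /dvdn_mulr; apply.
Qed.

Lemma abs_natrB (R : numDomainType) m n : `|m%:R - n%:R| = ((m - n) + (n - m))%:R :> R.
Proof.
wlog mn : m n / (n <= m)%N => [W|].
  by have [/W//|/ltnW/W] := leqP n m; rewrite distrC addnC.
by rewrite -natrB // normr_nat (eqP (mn : (n - m == 0)%N)) addn0.
Qed.

Section Equidistribution.

Variables (F : finFieldType) (p d s : nat) (f : {poly F}) (alpha : 'I_s -> F).
Hypotheses (pF : p \in [pchar F]) (f_size : size f = d.+1) (s_d : (s <= d %% p)%N).
Hypothesis alpha_inj : injective alpha.

Let p_pr : prime p := pcharf_prime pF.

Definition shift_comb (u : 'I_s -> 'F_p) : {poly F} :=
  \sum_i (f \Po ('X + (alpha i)%:P)) *+ (u i : nat).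

(** Vandermonde by interpolation: [P] vanishes at every [alpha k] except [alpha i]. *)
Lemma moments_eq0 (U : 'I_s -> F) :
  (forall j, (j < s)%N -> \sum_i U i * alpha i ^+ j = 0) -> forall i, U i = 0.
Proof.
move=> M i; pose P := \prod_(k <- enum (predC1 i)) ('X - (alpha k)%:P).
have sP : (size P <= s)%N.
  rewrite size_prod_XsubC -cardE cardC1 card_ord prednK //.
  exact: leq_ltn_trans (ltn_ord i).
have : \sum_k U k * P.[alpha k] = 0.
  under eq_bigr do rewrite (horner_coef_wide _ sP) mulr_sumr.
  rewrite exchange_big big1 // => j _ /=.
  under eq_bigr do rewrite mulrCA.
  by rewrite -mulr_sumr M ?mulr0.
rewrite (bigD1 i) //= [X in _ + X]big1 ?addr0 => [/eqP|k ki].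
  rewrite mulf_eq0 => /orP[/eqP //|]; rewrite horner_prod prodf_seq_eq0 => /hasP[k].
  by rewrite mem_enum !hornerE subr_eq0 => ki /eqP/alpha_inj ik; rewrite !inE ik eqxx in ki.
apply/eqP; rewrite mulf_eq0; apply/orP; right; rewrite horner_prod prodf_seq_eq0.
by apply/hasP; exists k; rewrite ?mem_enum // !hornerE subrr.
Qed.

(** The coefficient of X^k involves the moments of order at most d - k. All vanish when k > d - j0;
    at k = d - j0 there remains [lead_coef f] times the moment of order j0 times 'C(d, j0). *)
Lemma size_shift_comb u i0 : u i0 != 0 ->
  exists d', [/\ size (shift_comb u) = d'.+1, (0 < d' <= d)%N & coprime p d'].
Proof.
move=> ui0; pose U i : F := (u i : nat)%:R.
have Ui0 : U i0 != 0.
  rewrite /U -(dvdn_pcharf pF) gtnNdvd ?lt0n //.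
    by have := ltn_ord (u i0); rewrite [X in (_ < X)%N]Fp_cast.
have [j0 [j0s Mj0] j0_min] : exists2 j, (j < s)%N /\ \sum_i U i * alpha i ^+ j != 0
    & forall j', (j' < j)%N -> \sum_i U i * alpha i ^+ j' = 0.
  pose M j := (j < s)%N && (\sum_i U i * alpha i ^+ j != 0).
  have exM : exists j, M j.
    have [/existsP[j Mj]|noM] := boolP [exists j : 'I_s, \sum_i U i * alpha i ^+ j != 0].
      by exists j; rewrite /M ltn_ord.
    case/eqP: Ui0; apply: moments_eq0 => j js; apply/eqP.
    by move: noM; rewrite negb_exists => /forallP/(_ (Ordinal js)); rewrite negbK.
  case: (ex_minnP exM) => j /andP[js Mj] minj; exists j => //.
  move=> j' j'j; apply/eqP; apply: contraTT j'j => Mj'; rewrite -leqNgt.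
  have [sj'|j's] := leqP s j'; first by rewrite (leq_trans (ltnW js)).
  by apply: minj; rewrite /M j's.
have d_mod : (d %% p <= d)%N by apply: leq_mod.
have j0d : (j0 < d %% p)%N by apply: leq_trans j0s s_d.
have j0d' : (j0 < d)%N by apply: leq_trans j0d d_mod.
have coefh k : (shift_comb u)`_k =
    \sum_(m < d.+1) f`_m * (\sum_i U i * alpha i ^+ (m - k)) *+ 'C(m, k).
  rewrite coef_sum; under eq_bigr => i _.
    rewrite coefMn coef_comp_XaddC f_size -mulr_natl mulr_sumr.
    over.
  rewrite exchange_big; apply: eq_bigr => m _; rewrite mulr_sumr -sumrMnl.
  by apply: eq_bigr => i _; rewrite mulrnAr mulrCA !mulrnAr.
exists (d - j0)%N; split.
- have top : (shift_comb u)`_(d - j0) != 0.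
    rewrite coefh (bigD1 ord_max) //= [X in _ + X]big1 ?addr0.
      rewrite subKn ?bin_sub ?(ltnW j0d') //.
      rewrite -mulr_natr mulf_neq0 //; last first.
        by rewrite -(dvdn_pcharf pF) bin_pchar_neq0 // ltnW.
      rewrite mulf_neq0 // -[d in f`_d]/(d.+1.-1) -f_size -lead_coefE lead_coef_eq0.
      by rewrite -size_poly_eq0 f_size.
    move=> m mmax; have md : (m < d)%N.
      by rewrite ltn_neqAle -ltnS ltn_ord andbT; apply: contra mmax => /eqP md; apply/eqP/val_inj.
    have [dm|mk] := leqP (d - j0) m; last by rewrite bin_small // mulr0n.
    have mj : (m - (d - j0) < j0)%N.
      by move: md dm; move: (nat_of_ord m) => n; lia.
    by rewrite j0_min // mulr0 mul0rn.
  apply/eqP; rewrite eqn_leq; apply/andP; split; last first.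
    by rewrite ltnNge; apply: contra top => /leq_sizeP ->.
  apply/leq_sizeP => k dk; rewrite coefh big1 // => m _.
  have [km|mk] := leqP k m; last by rewrite bin_small // mulr0n.
  rewrite j0_min ?mulr0 ?mul0rn //.
  by move: km; have := ltn_ord m; move: (nat_of_ord m) => n; lia.
- by rewrite subn_gt0 j0d' leq_subr.
- rewrite prime_coprime // -eqn_mod_dvd ?(ltnW j0d') //; apply: contraL j0d => /eqP ->.
  by rewrite -leqNgt leq_mod.
Qed.

Variables (T : F -> 'F_p) (a0 : F) (c : 'I_s -> 'F_p).
Hypotheses (TD : {morph T : x y / x + y}) (Ta0 : T a0 != 0).

Lemma norm_count_le :
  `|#|[set xi | [forall i, T f.[xi + alpha i] == c i]]|%:R * p%:R ^+ s - #|F|%:R|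
    <= p%:R ^+ s * (d.-1)%:R * sqrtC #|F|%:R :> algC.
Proof.
have [chi chiP chi1] := exists_Fp_char p_pr.
have T0 : T 0 = 0 by apply: (addrI (T 0)); rewrite -TD !addr0.
have TMn x n : T (x *+ n) = T x *+ n by elim: n => [|n IHn]; rewrite ?mulr0n // !mulrS TD IHn.
have Tsum (G : 'I_s -> F) : T (\sum_i G i) = \sum_i T (G i) by apply: (big_morph T TD T0).
have chi_sum (G : 'I_s -> 'F_p) : \prod_i chi (G i) = chi (\sum_i G i).
  by apply/esym; apply: (big_morph chi chiP.2 chiP.1).
pose psi x := chi (T x).
have psiP : add_char psi by split=> [|x y]; rewrite /psi ?T0 ?chiP.1 // TD chiP.2.
have psi_a : psi (a0 *+ ((T a0)^-1 : 'F_p)) != 1.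
  by rewrite /psi TMn -mulr_natr natr_Zp mulfV.
pose S u := chi (- \sum_i u i * c i) * \sum_xi psi (shift_comb u).[xi].
have countE : #|[set xi | [forall i, T f.[xi + alpha i] == c i]]|%:R * p%:R ^+ s
    = \sum_(u : {ffun 'I_s -> 'F_p}) S u.
  transitivity (\sum_xi \prod_(i < s) \sum_u chi (u * (T f.[xi + alpha i] - c i))).
    rewrite -sum1_card natr_sum big_mkcond mulr_suml; apply: eq_bigr => xi _.
    under [RHS]eq_bigr do rewrite (sum_Fp_char _ p_pr chiP chi1).
    rewrite big_split /= prodr_const card_ord inE; congr (_ * _).
    case: forallP => [all_eq|not_all].
      by rewrite big1 // => i _; rewrite subr_eq0 all_eq.
    have [i iP] : exists i, T f.[xi + alpha i] != c i.
      by apply/existsP; rewrite -negb_forall; apply/forallP.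
    by rewrite (bigD1 i) //= subr_eq0 (negPf iP) mul0r.
  under eq_bigr do rewrite bigA_distr_bigA /=.
  rewrite exchange_big; apply: eq_bigr => u _; rewrite /S mulr_sumr; apply: eq_bigr => xi _ /=.
  rewrite chi_sum /psi -chiP.2; congr chi; rewrite addrC -sumrN /shift_comb horner_sum Tsum -big_split.
  apply: eq_bigr => i _ /=; rewrite mulrBr; congr (_ - _).
  by rewrite hornerMn TMn horner_comp !hornerE -mulr_natl natr_Zp.
pose z : {ffun 'I_s -> 'F_p} := [ffun=> 0].
have S0 : S z = #|F|%:R.
  rewrite /S big1 ?oppr0 ?chiP.1 ?mul1r => [|i _]; last by rewrite ffunE mul0r.
  rewrite (eq_bigr (fun=> 1)) => [|xi _]; first by rewrite sumr_const.
  by rewrite /shift_comb big1 ?horner0 ?psiP.1 // => i _; rewrite ffunE mulr0n.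
have sq0 : 0 <= sqrtC #|F|%:R :> algC by rewrite sqrtC_ge0 ler0n.
rewrite countE (bigD1 z) //= S0 addrAC subrr add0r.
apply: (le_trans (ler_norm_sum _ _ _)).
apply: (@le_trans _ _ (\sum_(u : {ffun 'I_s -> 'F_p} | u != z) (d.-1)%:R * sqrtC #|F|%:R)).
  apply: ler_sum => u u0.
  have [i ui] : exists i, u i != 0.
    apply/existsP; rewrite -negb_forall; apply: contra u0 => /forallP u0.
    by apply/eqP/ffunP => i; rewrite ffunE; apply/eqP.
  have [d' [sd' /andP[d'0 d'd] pd']] := size_shift_comb ui.
  rewrite /S normrM (norm_add_char chiP) mul1r.
  apply: (le_trans (weil_bound pF psiP psi_a d'0 pd' sd')).
  by rewrite ler_wpM2r // ler_nat -!subn1 leq_sub2r.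
rewrite sumr_const -[leLHS]mulr_natl -mulrA ler_wpM2r ?mulr_ge0 //.
rewrite -natrX ler_nat; apply: leq_trans (max_card _) _.
by rewrite card_ffun card_Fp // card_ord.
Qed.

(** Transfer from [algC]: squared, the inequality compares natural numbers, which are the same in
    every real closed field. *)
Lemma real_count_le (R : rcfType) :
  `|#|[set xi | [forall i, T f.[xi + alpha i] == c i]]|%:R * p%:R ^+ s - #|F|%:R|
    <= p%:R ^+ s * (d.-1)%:R * Num.sqrt #|F|%:R :> R.
Proof.
have := norm_count_le; set N := #|_|; rewrite -!natrX -!natrM !abs_natrB.
set x := (_ + _)%N; set y := (_ * _)%N => xy.
have : (x ^ 2 <= y ^ 2 * #|F|)%N.
  rewrite -(ler_nat algC) natrM !natrX -[#|F|%:R]sqrtCK -exprMn.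
  by rewrite ler_pXn2r ?nnegrE ?mulr_ge0 // sqrtC_ge0.
rewrite -(ler_nat R) natrM !natrX => xyR.
rewrite -(@ler_pXn2r _ 2) ?nnegrE ?mulr_ge0 ?sqrtr_ge0 //.
by rewrite exprMn sqr_sqrtr.
Qed.

End Equidistribution.

(** * Functional degree *)

Fixpoint fdeg_le (R : nzRingType) n (G : R -> R) : Prop :=
  if n is n'.+1 then forall v, fdeg_le n' (fun x => G (x + v) - G x)
  else forall v x, G (x + v) = G x.

Section FunctionalDegree.

Variable R : comNzRingType.
Implicit Types (G H : R -> R) (n : nat).

Lemma eq_fdeg_le n G H : G =1 H -> fdeg_le n G -> fdeg_le n H.
Proof.
elim: n G H => [|n IHn] G H GH Gn v /=; first by move=> x; rewrite -!GH.
by apply: IHn (Gn v) => x; rewrite !GH.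
Qed.

Lemma fdeg_leD n G H : fdeg_le n G -> fdeg_le n H -> fdeg_le n (fun x => G x + H x).
Proof.
elim: n G H => [|n IHn] G H Gn Hn v /=; first by move=> x; rewrite Gn Hn.
by apply: eq_fdeg_le (IHn _ _ (Gn v) (Hn v)) => x; ring.
Qed.

Lemma fdeg_leZ n a G : fdeg_le n G -> fdeg_le n (fun x => a * G x).
Proof.
elim: n G => [|n IHn] G Gn v /=; first by move=> x; rewrite Gn.
by apply: eq_fdeg_le (IHn _ (Gn v)) => x; ring.
Qed.

Lemma fdeg_le_cst n a : fdeg_le n (fun=> a : R).
Proof.
elim: n a => [|n IHn] a v //=.
by apply: eq_fdeg_le (IHn 0) => x; rewrite subrr.
Qed.

Lemma fdeg_le_sum n (I : Type) (r : seq I) (G : I -> R -> R) :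
  (forall i, fdeg_le n (G i)) -> fdeg_le n (fun x => \sum_(i <- r) G i x).
Proof.
move=> Gn; elim: r => [|i r IHr].
  by apply: eq_fdeg_le (fdeg_le_cst n 0) => x; rewrite big_nil.
by apply: eq_fdeg_le (fdeg_leD (Gn i) IHr) => x; rewrite big_cons.
Qed.

Lemma fdeg_le_comp n G (phi : R -> R) : {morph phi : x y / x + y} ->
  fdeg_le n G -> fdeg_le n (G \o phi).
Proof.
move=> phiD; elim: n G => [|n IHn] G Gn v /=; first by move=> x; rewrite phiD Gn.
by apply: eq_fdeg_le (IHn _ (Gn (phi v))) => x; rewrite /= phiD.
Qed.

Lemma fdeg_le_shift n G v : fdeg_le n G -> fdeg_le n (fun x => G (x + v)).
Proof.
elim: n G => [|n IHn] G Gn w /=; first by move=> x; rewrite !Gn.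
by apply: eq_fdeg_le (IHn _ (Gn w)) => x; rewrite addrAC.
Qed.

Lemma fdeg_leS n G : fdeg_le n G -> fdeg_le n.+1 G.
Proof.
elim: n G => [|n IHn] G Gn v /=; last by move=> w; apply: IHn (Gn v) w.
by move=> w x; rewrite !Gn !subrr.
Qed.

Lemma fdeg_le_mono m n G : (m <= n)%N -> fdeg_le m G -> fdeg_le n G.
Proof.
move=> /subnK <-; elim: (n - m)%N => // k IHk /IHk; rewrite addSn.
exact: fdeg_leS.
Qed.

(** Product rule: the difference of x G(x) is x times that of G, plus v G(x + v). *)
Lemma fdeg_le_mulX n G : fdeg_le n G -> fdeg_le n.+1 (fun x => x * G x).
Proof.
elim: n G => [|n IHn] G Gn v /=.
  by move=> w x; rewrite !Gn; ring.
apply: (@eq_fdeg_le n.+1 (fun x => x * (G (x + v) - G x) + v * G (x + v))) => [x|].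
  by ring.
by apply: fdeg_leD (IHn _ (Gn v)) _; apply/fdeg_leZ/fdeg_le_shift.
Qed.

Lemma fdeg_le_mulXn n k G : fdeg_le n G -> fdeg_le (n + k) (fun x => x ^+ k * G x).
Proof.
move=> Gn; elim: k => [|k IHk].
  by rewrite addn0; apply: eq_fdeg_le Gn => x; rewrite mul1r.
rewrite addnS; apply: eq_fdeg_le (fdeg_le_mulX IHk) => x.
by rewrite exprS mulrA.
Qed.

(* The functional degree of x ^+ k is at most the sum of the base-p digits of k, *)
(* and k.+1 < (b + 2) * p ^ m bounds that sum by m * (p - 1) + b.                *)
Lemma fdeg_le_Xn p m b k : p \in [pchar R] -> (k.+1 < (b + 2) * p ^ m)%N ->
  fdeg_le (m * p.-1 + b) (fun x : R => x ^+ k).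
Proof.
move=> pR; have p_pr := pcharf_prime pR; have p1 := prime_gt1 p_pr.
elim: m b k => [|m IHm] b k kb.
  have kb' : (k <= b)%N by move: kb; rewrite muln1; lia.
  rewrite add0n; apply: (fdeg_le_mono kb').
  by apply: eq_fdeg_le (fdeg_le_mulXn k (fdeg_le_cst 0 1)) => x; rewrite mulr1.
have pD : {morph (fun x : R => x ^+ p) : x y / x + y}.
  by move=> x y; have := pcharXnD 1 x y pR; rewrite expn1.
have kE := divn_eq k p; have k0p := ltn_pmod k (prime_gt0 p_pr).
set k1 := (k %/ p)%N in kE; set k0 := (k %% p)%N in kE k0p.
have split_k n : fdeg_le n (fun x : R => x ^+ k1) -> (n + k0 <= m.+1 * p.-1 + b)%N ->
    fdeg_le (m.+1 * p.-1 + b) (fun x : R => x ^+ k).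
  move=> k1n nk; apply: (fdeg_le_mono nk).
  apply: eq_fdeg_le (fdeg_le_mulXn k0 (fdeg_le_comp pD k1n)) => x /=.
  by rewrite -exprM -exprD kE mulnC addnC.
(* A last digit p - 1 uses up the whole p - 1; a smaller one leaves room to raise [b] by one for the
   quotient [k1]. *)
have [k0E|k0E] := eqVneq k0 p.-1.
  apply: (split_k (m * p.-1 + b)%N); last by rewrite k0E mulSn; lia.
  apply: IHm; rewrite -(ltn_pmul2r (prime_gt0 p_pr)) -mulnA -expnSr mulSn.
  by apply: leq_ltn_trans kb; rewrite [in leqRHS]kE k0E; lia.
apply: (split_k (m * p.-1 + b.+1)%N); last by rewrite mulSn; lia.
apply: IHm; apply: (@leq_trans ((b + 2) * p ^ m).+1); last first.
  by rewrite addSn mulSn -addn1 addnC leq_add2r expn_gt0 ltnW.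
rewrite ltnS -(ltn_pmul2r (prime_gt0 p_pr)) -mulnA -expnSr.
by apply: leq_trans kb; rewrite [in leqRHS]kE; lia.
Qed.

Lemma fdeg_le_horner n (f : {poly R}) :
  (forall k, (k < size f)%N -> fdeg_le n (fun x : R => x ^+ k)) ->
  fdeg_le n (fun x => f.[x]).
Proof.
move=> Xn.
apply: (@eq_fdeg_le n (fun x => \sum_(i < size f) f`_i * x ^+ i)) => [x|].
  by rewrite horner_coef.
by apply: fdeg_le_sum => i; apply/fdeg_leZ/Xn.
Qed.

End FunctionalDegree.

(** * Combinations of shifts that make a function constant *)

Section Annihilator.

Variables (p : nat) (L : fieldExtType 'F_p).
Hypothesis p_pr : prime p.

(** These are [e] differences in the single direction [v], expanded; b 0 is 1 up to sign. *)
Lemma difference_combination n e (v : L) : exists b : nat -> 'F_p,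
  [/\ b 0%N != 0, forall c, (e < c)%N -> b c = 0 & forall G, fdeg_le (n + e) G ->
    fdeg_le n (fun x => \sum_(c < e.+1) b c *: G (x + v *+ c))].
Proof.
elim: e => [|e [b [b0 bz bG]]].
  exists (fun c => (c == 0%N)%:R); split=> [||G]; rewrite ?oner_eq0 //.
    by case.
  by rewrite addn0; apply: eq_fdeg_le => x; rewrite big_ord1 scale1r mulr0n addr0.
exists (fun c => (if c is c'.+1 then b c' else 0) - b c); split.
- by rewrite sub0r oppr_eq0.
- by case=> // c ec; rewrite !bz ?subrr //; lia.
move=> G; rewrite addnS => /(_ v) Gn; apply: eq_fdeg_le (bG _ Gn) => x.
under [RHS]eq_bigr do rewrite scalerBl.
rewrite sumrB [X in _ = X - _]big_ord_recl [X in _ = _ - X]big_ord_recr /=.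
rewrite scale0r add0r bz // scale0r addr0 -sumrB; apply: eq_bigr => c _.
by rewrite scalerBr /bump /= mulrS -addrA (addrC v).
Qed.

(** [A] pairs shifts with coefficients; the subspace [U] is recorded so that the next direction can
    be taken outside it. *)
Definition annihilator w N m (A : seq (L * 'F_p)) (U : {vspace L}) :=
  [/\ uniq (map fst A) /\ size A = N, (\dim U <= m)%N,
      {subset map fst A <= U}, has (fun a => a.2 != 0) A
    & forall G, fdeg_le w G ->
        forall x y, \sum_(a <- A) a.2 *: G (x + a.1) = \sum_(a <- A) a.2 *: G (y + a.1)].

Lemma annihilator0 : annihilator 0 1 0 [:: (0, 1)] 0%VS.
Proof.
split=> //; rewrite ?dimv0 //=.
- by move=> x; rewrite inE memv0.
move=> G Gc x y; have G0 z : G z = G 0 by rewrite -(add0r z) Gc.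
by rewrite !big_seq1 !(G0 (_ + _)).
Qed.

(** For v outside [U] the multiples c v with c <= e < p lie in different cosets of [U], so all
    shifts a + c v are distinct. *)
Lemma annihilatorS w N m A U e : (m < \dim {:L})%N -> (e < p)%N ->
  annihilator w N m A U ->
  exists A' U', annihilator (w + e) (N * e.+1) m.+1 A' U'.
Proof.
move=> mL ep [[A_uniq A_size] Um AU A_nz A_ann].
have /subvPn[v _ vU] : ~~ (fullv <= U)%VS.
  by apply: contraL mL => /dimvS; rewrite -leqNgt => /leq_trans; apply.
have [b [b0 _ bG]] := difference_combination w e v.
exists [seq (a.1 + v *+ c, a.2 * b c) | a <- A, c <- iota 0 e.+1], (U + <[v]>)%VS.
have vc c c' (a a' : L) : a \in U -> a' \in U -> (c <= c')%N -> (c' < p)%N ->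
    a + v *+ c = a' + v *+ c' -> c = c'.
  move=> aU a'U cc' c'p aE.
  have {}aE : v *+ (c' - c) = a - a'.
    by rewrite mulrnBr // -[a](addrK (v *+ c)) aE; ring.
  have [c0|c0] := posnP (c' - c); first by apply/eqP; rewrite eqn_leq cc' -subn_eq0 c0.
  have cF : (c' - c)%:R != 0 :> 'F_p.
    by rewrite -(dvdn_pcharf (pchar_Fp p_pr)) gtnNdvd // (leq_ltn_trans (leq_subr _ _)).
  case/negP: vU; rewrite -[v]scale1r -(mulVf cF) -scalerA memvZ // scaler_nat aE memvB //.
split.
- split; last by rewrite size_allpairs A_size size_iota.
  rewrite map_allpairs.
  have -> : [seq (a.1 + v *+ c, a.2 * b c).1 | a <- A, c <- iota 0 e.+1]
      = [seq a + v *+ c | a <- map fst A, c <- iota 0 e.+1] by rewrite allpairs_mapl.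
  apply: allpairs_uniq A_uniq (iota_uniq _ _) _ => -[a c] [a' c'].
  case/allpairsPdep=> a1 [c1 [/AU a1U c1s [-> ->]]].
  case/allpairsPdep=> a2 [c2 [/AU a2U c2s [-> ->]]] /= aE.
  rewrite !mem_iota !add0n !ltnS /= in c1s c2s.
  have cE : c1 = c2.
    case: (leqP c1 c2) => [le|/ltnW le].
      exact: vc a1U a2U le (leq_ltn_trans c2s ep) aE.
    exact/esym/(vc _ _ _ _ a2U a1U le (leq_ltn_trans c1s ep) (esym aE)).
  by move: aE; rewrite cE => /addIr ->.
- apply: leq_trans (dimv_add_leqif U <[v]>).1 _; by rewrite dim_vline -(addn1 m) leq_add // leq_b1.
- move=> z /mapP[w0 w0A ->]; case/allpairsPdep: w0A => a [c [aA _ ->]] /=.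
  by rewrite memv_add ?AU ?map_f // rpredMn // memv_line.
- have /hasP[a aA a0] := A_nz; apply/hasP; exists (a.1 + v *+ 0, a.2 * b 0%N).
    by apply/allpairsPdep; exists a, 0%N.
  by rewrite /= mulf_neq0.
move=> G Gw x y; rewrite !big_allpairs_dep /=.
have sumE z : \sum_(a <- A) \sum_(c <- iota 0 e.+1) (a.2 * b c) *: G (z + (a.1 + v *+ c))
    = \sum_(a <- A) a.2 *: (\sum_(c < e.+1) b c *: G (z + a.1 + v *+ c)).
  apply: eq_bigr => a _; rewrite scaler_sumr -(big_mkord xpredT
    (fun c => a.2 *: (b c *: G (z + a.1 + v *+ c)))) /index_iota subn0.
  by apply: eq_bigr => c _; rewrite scalerA addrA.
by rewrite !sumE; apply: (A_ann _ (bG _ Gw)).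
Qed.

Lemma exists_annihilator m b : (m <= \dim {:L})%N -> (b < p)%N ->
    (b == 0%N) || (m < \dim {:L})%N ->
  exists A U, annihilator (m * p.-1 + b) (p ^ m * b.+1) m.+1 A U.
Proof.
move=> mL bp bm; have p0 := prime_gt0 p_pr.
have [A [U AU]] : exists A U, annihilator (m * p.-1) (p ^ m) m A U.
  elim: m mL {bm} => [|m IHm] mL.
    by exists [:: (0, 1)], 0%VS; apply: annihilator0.
  have [A [U /(annihilatorS (e := p.-1) mL)]] := IHm (ltnW mL).
  by rewrite prednK // -expnSr mulSn addnC; apply; rewrite leqnn.
have [->|b0] := eqVneq b 0%N.
  by exists A, U; case: AU => *; rewrite addn0 muln1; split=> //; apply: leqW.
by move: bm; rewrite (negPf b0) => m_dim; apply: annihilatorS m_dim bp AU.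
Qed.

(** Here b + 1 is the leading base-p digit of d + 1, so p^m (b + 1) <= d + 1 < p^m (b + 2). The left
    side bounds the number of shifts; the right side gives every x^k with k <= d functional degree
    at most m (p - 1) + b. *)
Lemma constant_shift_combination d (f : {poly L}) : size f = d.+1 ->
    (d < p ^ \dim {:L})%N ->
  exists A : seq (L * 'F_p), [/\ uniq (map fst A), (size A <= d.+1)%N,
    has (fun a => a.2 != 0) A
    & forall x y, \sum_(a <- A) a.2 *: f.[x + a.1] = \sum_(a <- A) a.2 *: f.[y + a.1]].
Proof.
move=> fd dL; have p1 := prime_gt1 p_pr.
pose m := trunc_log p d.+1; pose b := (d.+1 %/ p ^ m).-1.
have pm0 : (0 < p ^ m)%N by rewrite expn_gt0 ltnW.
have /andP[pm pm1] : (p ^ m <= d.+1 < p ^ m.+1)%N by apply: trunc_log_bounds.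
have bE : b.+1 = (d.+1 %/ p ^ m)%N by rewrite prednK // divn_gt0.
have bp : (b.+1 < p)%N by rewrite bE ltn_divLR // -expnS.
have bd : (p ^ m * b.+1 <= d.+1)%N by rewrite bE mulnC leq_divM.
have db : (d.+1 < b.+2 * p ^ m)%N by rewrite bE ltn_ceil.
have mL : (m <= \dim {:L})%N by rewrite -(leq_exp2l _ _ p1) (leq_trans pm).
have bm : (b == 0%N) || (m < \dim {:L})%N.
  have [b0|b0] := posnP b; apply/orP; [by left; apply/eqP|right].
  rewrite -(ltn_exp2l _ _ p1); apply: leq_trans (leq_trans bd dL).
  by rewrite -{1}[(p ^ m)%N]muln1 ltn_pmul2l.
have [A [U [[A_uniq A_size] _ _ A_nz A_ann]]] := exists_annihilator mL (ltnW bp) bm.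
exists A; split=> // [|x y]; first by rewrite A_size.
apply: (A_ann (fun x => f.[x])); apply: fdeg_le_horner => k; rewrite fd => kd.
apply: (fdeg_le_Xn (p := p)); first by rewrite pchar_lalg pchar_Fp.
by rewrite addn2; apply: leq_ltn_trans db.
Qed.

End Annihilator.

(** * The digit function and the three clauses *)

Section SumDigits.

Variables (p r : nat) (L : fieldExtType 'F_p) (beta : r.-tuple L).
Hypotheses (p_pr : prime p) (beta_basis : basis_of fullv beta).

Lemma dim_basis : \dim {:L} = r.
Proof. by rewrite -(size_basis beta_basis). Qed.

Lemma card_basis : #|finvect_type L| = (p ^ r)%N.
Proof.
have := card_vspace (fullv : {vspace finvect_type L}).
rewrite card_Fp // (dim_basis : \dim (fullv : {vspace finvect_type L}) = r) => <-.
by apply/esym/eq_card => z; rewrite memvf.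
Qed.

Lemma sum_digitsD : {morph sum_digits beta : x y / x + y}.
Proof.
by move=> x y; rewrite /sum_digits -big_split; apply: eq_bigr => i _; rewrite linearD.
Qed.

Lemma sum_digitsZ a x : sum_digits beta (a *: x) = a * sum_digits beta x.
Proof. by rewrite mulr_sumr; apply: eq_bigr => i _; rewrite linearZ. Qed.

Lemma sum_digits_sum (I : Type) (s : seq I) (G : I -> L) :
  sum_digits beta (\sum_(i <- s) G i) = \sum_(i <- s) sum_digits beta (G i).
Proof.
by apply: (big_morph _ sum_digitsD); rewrite -(scale0r 0) sum_digitsZ mul0r.
Qed.

Lemma sum_digits_beta (i : 'I_r) : sum_digits beta beta`_i = 1.
Proof.
rewrite /sum_digits (bigD1 i) //= coord_free ?(basis_free beta_basis) // eqxx big1 ?addr0 //.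
by move=> j ji; rewrite coord_free ?(basis_free beta_basis) // eq_sym (negPf ji).
Qed.

Lemma TM_set_pigeonhole s (f : {poly L}) (alpha : s.-tuple L) : (r < s)%N ->
  exists c : s.-tuple 'F_p, TM_set beta c alpha f = set0.
Proof.
move=> rs; pose g (xi : finvect_type L) :=
  [tuple sum_digits beta f.[(xi : L) + tnth alpha i] | i < s].
have : ~~ ([set: s.-tuple 'F_p] \subset g @: [set: finvect_type L]).
  apply/negP => /subset_leq_card; apply/negP; rewrite -ltnNge.
  rewrite (leq_ltn_trans (leq_imset_card _ _)) // !cardsT card_basis card_tuple card_Fp //.
  by rewrite ltn_exp2l // prime_gt1.
case/subsetPn=> c _ cg; exists c; apply/setP => xi; rewrite !inE.
apply/negP => /forallP xiP; case/negP: cg; apply/imsetP; exists xi => //.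
by apply: eq_from_tnth => i; rewrite tnth_mktuple (eqP (xiP i)).
Qed.

(** The digits at the shifts of [A] satisfy a linear relation with fixed value [t], whereas [c]
    would give it the value t + 1. The other shifts only fill the tuple up to length s. *)
Lemma TM_set_empty d s (f : {poly L}) : size f = d.+1 -> (d < p ^ r)%N ->
    (d < s)%N -> (s <= p ^ r)%N ->
  exists alpha : s.-tuple L, uniq alpha /\
    exists c : s.-tuple 'F_p, TM_set beta c alpha f = set0.
Proof.
move=> fd dr ds sr; have dL : (d < p ^ \dim {:L})%N by rewrite dim_basis.
have [A [A_uniq A_size /(has_nthP (0, 0))[i0 i0A a0] A_cst]] :=
  constant_shift_combination p_pr fd dL.
pose rest := filter [predC map fst A] (enum (finvect_type L) : seq L).
pose al := take s (map fst A ++ rest).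
have al_uniq : uniq (map fst A ++ rest).
  rewrite cat_uniq A_uniq filter_uniq ?(enum_uniq (finvect_type L)) // andbT /=.
  by apply/hasPn => z; rewrite mem_filter => /andP[].
have al_size : size al == s.
  rewrite size_takel // (leq_trans sr) // -card_basis cardE uniq_leq_size ?enum_uniq //.
  move=> z _; rewrite mem_cat mem_filter /= (mem_enum (finvect_type L)) andbT.
  exact: orbN.
have As : (size A <= s)%N := leq_trans A_size ds.
have i0s : (i0 < s)%N := leq_trans i0A As.
pose alpha : s.-tuple L := Tuple al_size; exists alpha; split.
  exact: take_uniq.
have alphaE (i : 'I_s) : (i < size A)%N -> tnth alpha i = (nth (0, 0) A i).1.
  move=> iA; rewrite (tnth_nth 0) /= nth_take // nth_cat size_map iA.
  by rewrite (nth_map (0, 0)).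
pose t := sum_digits beta (\sum_(a <- A) a.2 *: f.[0 + a.1]).
exists [tuple if i == Ordinal i0s then (t + 1) / (nth (0, 0) A i0).2 else 0 | i < s].
apply/setP => xi; rewrite !inE; apply/negP => /forallP xiP.
suff : t = t + 1 by move/eqP; rewrite -subr_eq0 opprD addrA subrr sub0r oppr_eq0 oner_eq0.
rewrite {1}/t (A_cst 0 (xi : L)) sum_digits_sum (big_nth (0, 0)) big_mkord.
have sdE j : (j < size A)%N -> sum_digits beta ((nth (0, 0) A j).2 *: f.[(xi : L) + (nth (0, 0) A j).1])
    = if j == i0 then t + 1 else 0.
  move=> jA; have js : (j < s)%N := leq_trans jA As.
  have /eqP := xiP (Ordinal js); rewrite alphaE //= tnth_mktuple sum_digitsZ => ->.
  rewrite -[Ordinal js == _]/(j == i0).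
  by case: eqP => [->|]; rewrite ?mulr0 // mulrC divfK.
rewrite (bigD1 (Ordinal i0A)) //= sdE // eqxx big1 ?addr0 // => j ji.
by rewrite sdE // ifF //; apply: contraNF ji => /eqP ji; apply/eqP/val_inj.
Qed.

End SumDigits.

Theorem theorem3 (R : rcfType) (p r q : nat) (p_prime : prime p)
    (r_ge1 : (1 <= r)%N) (qE : q = (p ^ r)%N)
    (L : fieldExtType 'F_p) (beta : r.-tuple L)
    (beta_basis : basis_of fullv beta)
    (d : nat) (d_ge1 : (1 <= d)%N) (d_ltq : (d < q)%N) (d_coq : gcdn d q = 1%N)
    (d0 : nat) (d0_mod : d0 = d %[mod p]) (d0_ge1 : (1 <= d0)%N)
    (d0_ltp : (d0 < p)%N) :
  [/\ (forall f : {poly L}, size f = d.+1 ->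
        forall s : nat, (1 <= s)%N -> (s <= d0)%N ->
        forall alpha : s.-tuple L, uniq alpha ->
        forall c : s.-tuple 'F_p,
        `| #|TM_set beta c alpha f|%:R - p%:R ^ (r%:Z - s%:Z) |
          <= (d%:R - 1) * Num.sqrt q%:R :> R),
      (forall f : {poly L}, size f = d.+1 -> f \is a polyOver 1%VS ->
        forall s : nat, (d.+1 <= s)%N -> (s <= q)%N ->
        exists alpha : s.-tuple L, uniq alpha /\
          exists c : s.-tuple 'F_p, TM_set beta c alpha f = set0)
    & (forall f : {poly L}, size f = d.+1 ->
        forall s : nat, (d * r < s)%N -> (s <= q)%N ->
        forall alpha : s.-tuple L, uniq alpha ->
        exists c : s.-tuple 'F_p, TM_set beta c alpha f = set0)].
Proof.
split=> f fd.
- move=> s s_ge1 s_d0 alpha alpha_uniq c.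
  have pF : p \in [pchar finvect_type L] by rewrite pchar_lalg pchar_Fp.
  have sd : (s <= d %% p)%N by rewrite -d0_mod modn_small.
  have alpha_inj : injective (tnth alpha) by apply/tuple_uniqP.
  have T0 : sum_digits beta beta`_(Ordinal r_ge1) != 0.
    by rewrite (sum_digits_beta beta_basis) oner_eq0.
  have := @real_count_le (finvect_type L) p d s f (tnth alpha) pF fd sd alpha_inj
    (sum_digits beta) _ (tnth c) (@sum_digitsD _ _ _ beta) T0 R.
  rewrite -/(TM_set beta c alpha f) (card_basis p_prime beta_basis) -qE.
  have p0 : 0 < p%:R :> R by rewrite ltr0n prime_gt0.
  have -> : p%:R ^ (r%:Z - s%:Z) = q%:R / p%:R ^+ s :> R.
    by rewrite expfzDr ?gt_eqF // -exprnN qE natrX.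
  have ps : 0 < p%:R ^+ s :> R by rewrite exprn_gt0.
  have dE : (d.-1)%:R = d%:R - 1 :> R by rewrite -subn1 natrB.
  rewrite dE => count_le.
  have -> : #|TM_set beta c alpha f|%:R - q%:R / p%:R ^+ s
      = (#|TM_set beta c alpha f|%:R * p%:R ^+ s - q%:R) / p%:R ^+ s :> R.
    by rewrite mulrBl mulfK ?gt_eqF.
  by rewrite normrM normfV (gtr0_norm ps) ler_pdivrMr // [leRHS]mulrC mulrA.
- by move=> _ s ds sq; apply: (TM_set_empty p_prime beta_basis fd); rewrite -?qE.
- move=> s drs _ alpha _; apply: (TM_set_pigeonhole p_prime beta_basis).
  by apply: leq_ltn_trans drs; apply: leq_pmull.
Qed.
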